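(* Let $G$ be a series-parallel digraph with $sp$-tree $T$ and a multiflow instance on $G$. Any multiflow in $G$ can efficiently (in polynomial time) be turned into an almost unsplittable multiflow that satisfies the same demands and has the same total flow.
   Context: Digraphs may have parallel arcs. A digraph $G=(V,E)$ is series-parallel with start node $u_0$ and end node $v_0$ if (recursively): (1) it is a single arc from $u_0$ to $v_0$; or (2) it is a series composition of series-parallel digraphs $G_1,G_2$ with start/end nodes $u_1,v_1$ and $u_2,v_2$: arc sets disjoint, $V=V_1\cup V_2$, $E=E_1\cup E_2$, $u_0=u_1$, $v_1=u_2$, $v_0=v_2$, $V_1\cap V_2=\{v_1\}$; or (3) it is a parallel composition: arc sets disjoint, $V=V_1\cup V_2$, $E=E_1\cup E_2$, $u_0=u_1=u_2$, $v_0=v_1=v_2$, $V_1\cap V_2=\{u_0,v_0\}$. An $sp$-tree $T=(V_T,E_T)$ of $G$ is a rooted binary tree recording such a decomposition: each node $\omega\in V_T$ represents a series-parallel subdigraph $G_\omega=(V_\omega,E_\omega)$ with start node $u_\omega$ and end node $v_\omega$; the root represents $G$; leaves ($q$-nodes) represent single arcs of $G$; for an $s$-node (resp. $p$-node) $\omega$ with children $\omega_1,\omega_2$, $G_\omega$ is the series (resp. parallel) composition of $G_{\omega_1}$ and $G_{\omega_2}$. Let $V^\circ_\omega=V_\omega\setminus\{u_\omega,v_\omega\}$. A multiflow instance consists of commodities $i\in[k]=\{1,\dots,k\}$ with source-sink pairs $(s_i,t_i)\in V\times V$ and demands $d_i>0$, where $s_i\ne t_i$ and $G$ contains an $s_i$–$t_i$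 path. A multiflow $X=(X_{e,i})_{e\in E,i\in[k]}$ consists of values $X_{e,i}\ge0$ such that for all $v,i$ the net outflow $\sum_{e\in\delta^+(v)}X_{e,i}-\sum_{e\in\delta^-(v)}X_{e,i}$ equals $d_i$ if $v=s_i$, $-d_i$ if $v=t_i$, and $0$ otherwise. Its total flow is $(x_e)_{e\in E}$, $x_e=\sum_iX_{e,i}$. The demand share of commodity $i$ at $\omega\in V_T$ is $z_{\omega,i}(X)=1$ if $V^\circ_\omega\cap\{s_i,t_i\}\ne\emptyset$, and otherwise $z_{\omega,i}(X)=\frac1{d_i}\sum_{e\in\delta^+_\omega(u_\omega)}X_{e,i}$, where $\delta^+_\omega(u_\omega)$ is the set of arcs of $G_\omega$ leaving $u_\omega$. Let $I_\omega(X)=\{i\in[k]:0<z_{\omega,i}(X)<1\}$ (commodities routed fractionally through $G_\omega$). A multiflow $X$ is almost unsplittable if (i) $|I_\omega(X)|\le2$ for every $\omega\in V_T$, and (ii) $|I_{\omega_1}(X)\cap I_{\omega_2}(X)|\le1$ for every $p$-node with children $\omega_1,\omega_2$. *)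

(* Defs.v *)
From mathcomp Require Import all_boot all_order all_algebra.

Set Implicit Arguments.
Unset Strict Implicit.
Unset Printing Implicit Defensive.

Import Order.TTheory GRing.Theory Num.Theory.
Local Open Scope ring_scope.

(* Nodes and arcs are numbered, as they are when a digraph is given as input
   data; arcs are named, so parallel arcs are allowed. *)
Record digraph := Digraph {
  nv : nat;
  na : nat;
  arc_tail : 'I_na -> 'I_nv;
  arc_head : 'I_na -> 'I_nv
}.

Definition adj (G : digraph) : rel 'I_(nv G) :=
  fun x y => [exists e : 'I_(na G), (arc_tail e == x) && (arc_head e == y)].

Inductive sptree (A : Type) :=
| QNode of A
| SNode of sptree A & sptree A
| PNode of sptree A & sptree A.

Section SPTrees.
Variable G : digraph.

Record subdigraph := Subdigraph {
  verts : {set 'I_(nv G)};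
  arcs : {set 'I_(na G)};
  startn : 'I_(nv G);
  endn : 'I_(nv G)
}.

(* The subdigraph G_w represented by a node w, which is identified with the
   subtree rooted at it. *)
Fixpoint subdig (w : sptree 'I_(na G)) : subdigraph :=
  match w with
  | QNode e =>
      Subdigraph [set arc_tail e; arc_head e] [set e] (arc_tail e) (arc_head e)
  | SNode w1 w2 =>
      Subdigraph (verts (subdig w1) :|: verts (subdig w2))
                 (arcs (subdig w1) :|: arcs (subdig w2))
                 (startn (subdig w1)) (endn (subdig w2))
  | PNode w1 w2 =>
      Subdigraph (verts (subdig w1) :|: verts (subdig w2))
                 (arcs (subdig w1) :|: arcs (subdig w2))
                 (startn (subdig w1)) (endn (subdig w1))
  end.

Definition series_compatible (H1 H2 : subdigraph) : Prop :=
  [/\ [disjoint arcs H1 & arcs H2], endn H1 = startn H2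
    & verts H1 :&: verts H2 = [set endn H1]].

Definition parallel_compatible (H1 H2 : subdigraph) : Prop :=
  [/\ [disjoint arcs H1 & arcs H2], startn H1 = startn H2, endn H1 = endn H2
    & verts H1 :&: verts H2 = [set startn H1; endn H1]].

(* Start and end node of a single arc are distinct: no loops. *)
Fixpoint sp_decomposition (w : sptree 'I_(na G)) : Prop :=
  match w with
  | QNode e => arc_tail e <> arc_head e
  | SNode w1 w2 => [/\ sp_decomposition w1, sp_decomposition w2
                     & series_compatible (subdig w1) (subdig w2)]
  | PNode w1 w2 => [/\ sp_decomposition w1, sp_decomposition w2
                     & parallel_compatible (subdig w1) (subdig w2)]
  end.

Definition is_sptree (T : sptree 'I_(na G)) : Prop :=
  [/\ sp_decomposition T, verts (subdig T) = [set: 'I_(nv G)]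
    & arcs (subdig T) = [set: 'I_(na G)]].

Fixpoint node_of (w T : sptree 'I_(na G)) : Prop :=
  w = T \/
  match T with
  | QNode _ => False
  | SNode T1 T2 | PNode T1 T2 => node_of w T1 \/ node_of w T2
  end.

Definition inner (w : sptree 'I_(na G)) : {set 'I_(nv G)} :=
  verts (subdig w) :\: [set startn (subdig w); endn (subdig w)].

End SPTrees.

Record multiflow_instance (R : realFieldType) (G : digraph) :=
  MultiflowInstance {
    nk : nat;
    src : 'I_nk -> 'I_(nv G);
    snk : 'I_nk -> 'I_(nv G);
    dem : 'I_nk -> R;
    dem_gt0 : forall i, 0 < dem i;
    src_neq_snk : forall i, src i <> snk i;
    src_snk_path : forall i, connect (@adj G) (src i) (snk i)
  }.

Section Multiflows.
Variables (R : realFieldType) (G : digraph) (I : multiflow_instance R G).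
Implicit Types (X : 'M[R]_(na G, nk I)) (w : sptree 'I_(na G)).

Definition net_outflow X (v : 'I_(nv G)) (i : 'I_(nk I)) : R :=
  \sum_(e | arc_tail e == v) X e i - \sum_(e | arc_head e == v) X e i.

Definition is_multiflow X : Prop :=
  (forall e i, 0 <= X e i) /\
  (forall v i, net_outflow X v i =
     if v == src i then dem i else if v == snk i then - dem i else 0).

Definition total_flow X (e : 'I_(na G)) : R := \sum_i X e i.

Definition demand_share X w (i : 'I_(nk I)) : R :=
  if inner w :&: [set src i; snk i] != set0 then 1
  else (\sum_(e in arcs (subdig w) | arc_tail e == startn (subdig w)) X e i)
         / dem i.

Definition fractional X w : {set 'I_(nk I)} :=
  [set i | 0 < demand_share X w i < 1].

Definition almost_unsplittable (T : sptree 'I_(na G)) X : Prop :=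
  (forall w, node_of w T -> (#|fractional X w| <= 2)%N) /\
  (forall w1 w2, node_of (PNode w1 w2) T ->
     (#|fractional X w1 :&: fractional X w2| <= 1)%N).

End Multiflows.

(* Model of computation: a while-RAM whose memory consists of arrays of natural
   numbers and arrays of elements of the ordered field R.  A program is a closed
   syntactic object that does not depend on R (it contains no field constants).
   Every assignment and every evaluation of a test costs one unit; expressions
   are part of the program text, so each of them stands for a constant number of
   machine operations.  Neither kind of data can be multiplied: with only
   addition, subtraction and comparison, t steps add at most O(t) bits to the
   length of any natural number, and for R = rat all computed numbers stay
   integer combinations of the input numbers, with coefficients of O(t) bits.
   Hence, on rational inputs, a number of steps polynomial in nv + na + nk is
   also polynomial time on a Turing machine. *)
Inductive iexp :=
| ICst of nat
| IGet of nat & iexp            (* array name, index *)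
| IAdd of iexp & iexp
| ISub of iexp & iexp.          (* truncated *)

Inductive rexp :=
| RGet of nat & iexp
| RAdd of rexp & rexp
| RSub of rexp & rexp.

Inductive bexp :=
| BILe of iexp & iexp
| BRLe of rexp & rexp
| BNot of bexp
| BAnd of bexp & bexp.

Inductive cmd :=
| Skip
| ISet of nat & iexp & iexp     (* array name, index, new value *)
| RSet of nat & iexp & rexp
| Seq of cmd & cmd
| If of bexp & cmd & cmd
| While of bexp & cmd.

Definition update (A : Type) (f : nat -> nat -> A) (a j : nat) (x : A) :
    nat -> nat -> A :=
  fun a' j' => if (a' == a) && (j' == j) then x else f a' j'.

Section Semantics.
Variable R : realFieldType.

Record state := State {
  imem : nat -> nat -> nat;
  rmem : nat -> nat -> R
}.

Fixpoint ieval (st : state) (x : iexp) : nat :=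
  match x with
  | ICst c => c
  | IGet a j => imem st a (ieval st j)
  | IAdd x1 x2 => (ieval st x1 + ieval st x2)%N
  | ISub x1 x2 => (ieval st x1 - ieval st x2)%N
  end.

Fixpoint reval (st : state) (x : rexp) : R :=
  match x with
  | RGet a j => rmem st a (ieval st j)
  | RAdd x1 x2 => reval st x1 + reval st x2
  | RSub x1 x2 => reval st x1 - reval st x2
  end.

Fixpoint beval (st : state) (b : bexp) : bool :=
  match b with
  | BILe x1 x2 => (ieval st x1 <= ieval st x2)%N
  | BRLe x1 x2 => reval st x1 <= reval st x2
  | BNot b1 => ~~ beval st b1
  | BAnd b1 b2 => beval st b1 && beval st b2
  end.

(* exec c st st' t: started in st, c halts in st' after t steps. *)
Inductive exec : cmd -> state -> state -> nat -> Prop :=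
| exec_skip st : exec Skip st st 0
| exec_iset st a j x :
    exec (ISet a j x) st
      (State (update (imem st) a (ieval st j) (ieval st x)) (rmem st)) 1
| exec_rset st a j x :
    exec (RSet a j x) st
      (State (imem st) (update (rmem st) a (ieval st j) (reval st x))) 1
| exec_seq c1 c2 st1 st2 st3 t1 t2 :
    exec c1 st1 st2 t1 -> exec c2 st2 st3 t2 ->
    exec (Seq c1 c2) st1 st3 (t1 + t2)%N
| exec_if_true b c1 c2 st st' t :
    beval st b -> exec c1 st st' t -> exec (If b c1 c2) st st' t.+1
| exec_if_false b c1 c2 st st' t :
    ~~ beval st b -> exec c2 st st' t -> exec (If b c1 c2) st st' t.+1
| exec_while_false b c st : ~~ beval st b -> exec (While b c) st st 1
| exec_while_true b c st1 st2 st3 t1 t2 :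
    beval st1 b -> exec c st1 st2 t1 -> exec (While b c) st2 st3 t2 ->
    exec (While b c) st1 st3 (t1 + t2)%N.+1.

End Semantics.

(* Polish (preorder) notation for sp-trees. *)
Fixpoint tree_code (m : nat) (w : sptree 'I_m) : seq nat :=
  match w with
  | QNode e => [:: (e : nat).+2]
  | SNode w1 w2 => 0%N :: tree_code w1 ++ tree_code w2
  | PNode w1 w2 => 1%N :: tree_code w1 ++ tree_code w2
  end.

Section InputOutput.
Variables (R : realFieldType) (G : digraph) (I : multiflow_instance R G).

Definition load (A : Type) (x0 : A) (s : seq (seq A)) : nat -> nat -> A :=
  fun a j => nth x0 (nth [::] s a) j.

(* Matrices are stored row by row; all cells outside the input contain 0. *)
Definition input_state (T : sptree 'I_(na G)) (X : 'M[R]_(na G, nk I)) :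
    state R :=
  State
    (load 0%N
       [:: [:: nv G; na G; nk I];
           [seq (arc_tail e : nat) | e <- enum 'I_(na G)];
           [seq (arc_head e : nat) | e <- enum 'I_(na G)];
           [seq (src i : nat) | i <- enum 'I_(nk I)];
           [seq (snk i : nat) | i <- enum 'I_(nk I)];
           tree_code T])
    (load 0
       [:: [seq dem i | i <- enum 'I_(nk I)];
           [seq X e i | e <- enum 'I_(na G), i <- enum 'I_(nk I)]]).

(* The result is left in field array 2. *)
Definition output (st : state R) : 'M[R]_(na G, nk I) :=
  \matrix_(e, i) rmem st 2 (e * nk I + i)%N.

Definition input_size : nat := (nv G + na G + nk I)%N.

End InputOutput.

(* Main.v *)
Require Import Defs.
From mathcomp Require Import all_boot all_order all_algebra.
From mathcomp Require Import zify lra.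

(* Walk down the sp-tree, choosing for every node w the amounts a_i that the
   commodities send through G_w. A commodity with a terminal strictly inside
   G_w keeps its amounts of X at both children; they are zero or its whole
   demand at a child in which it has no inner terminal. At an s-node the
   amounts of all other commodities are copied to both children. At a p-node,
   line the commodities up with one fractional commodity first and the other
   one last, and fill the first child in this order up to the total amount that
   it carries in X. Only the commodity at the cut can become fractional in both
   children, and each child inherits at most one further fractional commodity.
   The amounts at the leaves are the new multiflow. Its conservation law holds
   because the change of the flow through G_w is, for every commodity, a flow
   from the start to the end of G_w. Only additions, subtractions and
   comparisons of flow values are needed. *)

Set Implicit Arguments.
Unset Strict Implicit.
Unset Printing Implicit Defensive.
Import Order.TTheory GRing.Theory Num.Theory.
Local Open Scope ring_scope.

(** * Series-parallel structure *)

(** A cut in a linear order leaves every commodity but one undivided. The two commodities that may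
    arrive fractional stand at opposite ends of the order, so each side gets at most one of them
    besides the cut one. This keeps the bound two on the way down and yields the bound one at
    p-nodes. The obstacle is a commodity with a terminal inside a node. Its share there is 1 by
    definition, but at a child containing no terminal of it the share becomes an honest fraction and
    counts. This is harmless because of [within_demand]: a commodity with an inner source brings
    nothing in from outside, and one whose sink alone is inner brings in exactly its demand. Shares
    are never computed. Since demands are positive, the condition on a share becomes
    [0 < a i < dem i], so no division occurs. The program needs neither recursion nor a stack: read
    backwards, the preorder code meets children before parents, which suits the summation of the
    given flow; read forwards, it meets parents first, which suits the redistribution. *)

Section Structure.
Variable G : digraph.
Implicit Types (w l r : sptree 'I_(na G)) (v : 'I_(nv G)) (e : 'I_(na G)).

(** The last clause carries acyclicity: nothing leaves the end node and nothing enters the start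
    node. In a series composition it survives because the outer ends lie in one part only, the parts
    sharing just the middle node. *)
Lemma sp_decomposition_ends w : sp_decomposition w ->
  [/\ startn (subdig w) != endn (subdig w),
      startn (subdig w) \in verts (subdig w),
      endn (subdig w) \in verts (subdig w)
    & forall e, e \in arcs (subdig w) ->
      [/\ arc_tail e \in verts (subdig w), arc_head e \in verts (subdig w),
          arc_tail e != endn (subdig w) & arc_head e != startn (subdig w)]].
Proof.
elim: w => [e|l IHl r IHr|l IHl r IHr] /=.
- move=> /eqP ne; split; rewrite ?inE ?eqxx ?orbT // => e'.
  by rewrite !inE => /eqP->; rewrite !eqxx orbT eq_sym; split; rewrite // eq_sym.
- case=> /IHl[nl sl el al] /IHr[nr sr er ar] [_ mE VI].
  have Vm v : v \in verts (subdig l) -> v \in verts (subdig r) ->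
      v = endn (subdig l).
    by move=> vl vr; apply/eqP; rewrite -in_set1 -VI inE vl.
  have slr : startn (subdig l) \notin verts (subdig r).
    by apply: contraNN nl => /(Vm _ sl)->.
  have erl : endn (subdig r) \notin verts (subdig l).
    by apply: contraNN nr => /Vm/(_ er) ->; rewrite mE.
  split; rewrite ?inE ?sl ?er ?orbT //.
    by apply: contraNneq slr => ->.
  move=> e; rewrite !inE => /orP[/al|/ar] [vt vh ht hh]; rewrite vt vh ?orbT;
    split=> //.
    by apply: contraNneq erl => <-.
  by apply: contraNneq slr => <-.
- case=> /IHl[nl sl el al] /IHr[nr sr er ar] [_ sE eE _].
  split; rewrite ?inE ?sl ?el //.
  by move=> e; rewrite !inE => /orP[/al|/ar] [-> -> ht hh];
    rewrite ?orbT sE eE; split; rewrite // -?sE -?eE.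
Qed.

(** Stated as a count rather than a disjunction: the three cases exclude each other, so quantities
    weighted by membership in [inner] become additive. *)
Lemma inner_series l r v : sp_decomposition (SNode l r) ->
  (v \in inner (SNode l r) =
     (v \in inner l) + (v == endn (subdig l)) + (v \in inner r) :> nat)%N.
Proof.
case=> /sp_decomposition_ends[nl sl el _] /sp_decomposition_ends[nr sr er _].
case=> _ mE /setP VI.
have := VI v; have := VI (startn (subdig l)); have := VI (endn (subdig r)).
rewrite /inner /= !inE sl er andbT /= (negPf nl) mE eq_sym (negPf nr) => erl slr.
have [->|sv] := eqVneq v (startn (subdig l)).
  by rewrite slr /= -mE (negPf nl) !andbF.
have [->|ev] := eqVneq v (endn (subdig r)).
  by rewrite erl /= eq_sym (negPf nr) !orbT.
have [->|mv] := eqVneq v (startn (subdig r)); first by rewrite -mE el orbT.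
by do 2!case: (_ \in _).
Qed.

Lemma inner_parallel l r v : sp_decomposition (PNode l r) ->
  (v \in inner (PNode l r) = (v \in inner l) + (v \in inner r) :> nat)%N.
Proof.
case=> _ _ [_ sE eE /setP/(_ v)]; rewrite /inner /= !inE sE eE.
by do 2!case: (_ \in _); case: (_ == _); case: (_ == _).
Qed.

(** Only the two ends connect G_w to the rest of G. Conservation at an inner node can therefore be
    read off inside G_w. *)
Definition closed_at w : Prop := forall v, v \in inner w ->
  forall e, (arc_tail e == v) || (arc_head e == v) -> e \in arcs (subdig w).

Lemma inner_disjoint_verts l r v :
  (forall x, x \in verts (subdig l) -> x \in verts (subdig r) ->
     (x == startn (subdig l)) || (x == endn (subdig l))) ->
  v \in inner l -> v \notin verts (subdig r).
Proof.
move=> VI; rewrite !inE => /andP[nv vl].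
by apply: contraNN nv; exact: VI.
Qed.

(** An arc at an inner node of one child that belonged to the other child would make that node
    common to both, and common nodes are ends. *)
Lemma closed_at_series l r : sp_decomposition (SNode l r) ->
  closed_at (SNode l r) -> closed_at l /\ closed_at r.
Proof.
move=> sp cl; have [spl spr [_ mE /setP VI]] := sp.
have [_ _ _ al] := sp_decomposition_ends spl.
have [_ _ _ ar] := sp_decomposition_ends spr.
split=> v vi e ev.
  have: e \in arcs (subdig (SNode l r)).
    by apply: cl ev; rewrite -[_ \in _]lt0b inner_series // vi -addnA.
  rewrite inE => /orP[//|/ar[te he _ _]].
  have /negP[] : v \notin verts (subdig r).
    apply: inner_disjoint_verts vi => x xl xr.
    by have := VI x; rewrite !inE xl xr => <-; rewrite orbT.
  by case/orP: ev => /eqP <-.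
have: e \in arcs (subdig (SNode l r)).
  by apply: cl ev; rewrite -[_ \in _]lt0b inner_series // vi addnC.
rewrite inE => /orP[/al[te he _ _]|//].
have /negP[] : v \notin verts (subdig l).
  apply: inner_disjoint_verts vi => x xr xl.
  by have := VI x; rewrite !inE xl xr -mE => <-.
by case/orP: ev => /eqP <-.
Qed.

Lemma closed_at_parallel l r : sp_decomposition (PNode l r) ->
  closed_at (PNode l r) -> closed_at l /\ closed_at r.
Proof.
move=> sp cl; have [spl spr [_ sE eE /setP VI]] := sp.
have [_ _ _ al] := sp_decomposition_ends spl.
have [_ _ _ ar] := sp_decomposition_ends spr.
split=> v vi e ev.
  have: e \in arcs (subdig (PNode l r)).
    by apply: cl ev; rewrite -[_ \in _]lt0b inner_parallel // vi.
  rewrite inE => /orP[//|/ar[te he _ _]].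
  have /negP[] : v \notin verts (subdig r).
    apply: inner_disjoint_verts vi => x xl xr.
    by have := VI x; rewrite !inE xl xr => <-.
  by case/orP: ev => /eqP <-.
have: e \in arcs (subdig (PNode l r)).
  by apply: cl ev; rewrite -[_ \in _]lt0b inner_parallel // vi addnC.
rewrite inE => /orP[/al[te he _ _]|//].
have /negP[] : v \notin verts (subdig l).
  apply: inner_disjoint_verts vi => x xr xl.
  by have := VI x; rewrite !inE xl xr -sE -eE => <-.
by case/orP: ev => /eqP <-.
Qed.
End Structure.

(** * Splitting the commodities at a p-node *)

Section GreedySplit.
Variables (R : realFieldType) (n : nat).
Implicit Types (i j : 'I_n) (f g a d L : 'I_n -> R) (c : 'I_n -> nat).

(* A commodity with [d i <= a i] and [d i <= f i] (or [d i <= g i]) is routed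
   through one side only; it stays there. This covers the commodities whose sink
   lies strictly inside one side. *)
Definition excluded f g a d i : bool :=
  (d i <= a i) && ((d i <= f i) || (d i <= g i)).

(* Class 0 is filled first and contains at most one fractional commodity, class 1
   contains the unsplit ones, class 2 is filled last, and class 3 does not take
   part. *)
Definition classifies f g a d c : Prop :=
  [/\ forall i, excluded f g a d i -> c i = 3%N,
      forall i, ~~ excluded f g a d i ->
        if 0 < a i < d i then c i = 0%N \/ c i = 2%N else c i = 1%N,
      forall i j, c i = 0%N -> c j = 0%N -> i = j
    & forall i, c i = 2%N -> exists j, c j = 0%N].

(** Both class comparisons are weak: members of the class of [j] may lie on either side of the cut,
    and the count only needs the order of the classes. *)
Definition cut_at a L c i j : Prop :=
  L i = a i /\ (c i <= c j)%N \/ L i = 0 /\ (c j <= c i)%N.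

(** The first alternative of the last clause covers the case that no commodity can serve as the cut,
    for instance because all are excluded. *)
Definition greedy_split f g a d c L : Prop :=
  [/\ forall i, excluded f g a d i -> L i = f i,
      forall i, 0 <= L i <= a i,
      \sum_i L i = \sum_i f i
    & (forall i, ~~ excluded f g a d i -> L i = a i) \/
      exists2 j, ~~ excluded f g a d j &
        forall i, ~~ excluded f g a d i -> i != j -> cut_at a L c i j].

(** Classes 0 and 2 turn out to hold at most one commodity each. Besides the cut commodity, only the
    one in class 0 can be fractional on the first side and only the one in class 2 on the second; a
    commodity fractional on both sides must be the cut itself. *)
Lemma greedy_split_card f g a d c L :
  classifies f g a d c -> greedy_split f g a d c L ->
  (#|[set i | ~~ excluded f g a d i & 0 < a i < d i]%R| <= 2)%N ->
  [/\ (#|[set i | ~~ excluded f g a d i & 0 < L i < d i]%R| <= 2)%N,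
      (#|[set i | ~~ excluded f g a d i & 0 < a i - L i < d i]%R| <= 2)%N
    & (#|[set i | ~~ excluded f g a d i & 0 < L i < d i]%R :&:
         [set i | ~~ excluded f g a d i & 0 < a i - L i < d i]%R| <= 1)%N].
Proof.
move=> [c3 cN c0 c2] [LE La _ cut]; set S := [set i | _ & _] => S2.
set A := [set i | _ & _]; set B := [set i | _ & _].
have inS i : ~~ excluded f g a d i -> (i \in S) = (c i != 1%N).
  move=> ei; have := cN i ei; rewrite inE ei /=.
  by case: ifP => _ => [[]|] ->.
have cS i : i \in S -> c i = 0%N \/ c i = 2%N.
  by rewrite inE => /andP[/cN]; case: ifP.
have c2S i : c i = 2%N -> i \in S.
  move=> ci; have ei : ~~ excluded f g a d i by apply/negP => /c3; rewrite ci.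
  by rewrite inS // ci.
have c0S i : c i = 0%N -> i \in S.
  move=> ci; have ei : ~~ excluded f g a d i by apply/negP => /c3; rewrite ci.
  by rewrite inS // ci.
(* Two members of class 2, together with the member of class 0 that they require, would be three
   fractional commodities. *)
have c2u i j : c i = 2%N -> c j = 2%N -> i = j.
  move=> ci cj; apply: contraTeq S2 => ij; rewrite -ltnNge.
  have [k ck] := c2 _ ci.
  have -> : 3%N = #|[set k; i; j]|.
    rewrite -setUA cardsU1 cards2 ij !inE negb_or.
    by do 2!(case: eqP => [E|_]; first by move: ck; rewrite E ?ci ?cj).
  apply/subset_leq_card/subsetP => x.
  by rewrite !in_setU !in_set1 -orbA => /or3P[] /eqP->; [exact: c0S|exact: c2S..].
have card1 j (C : {set 'I_n}) :
    {in C :\ j &, forall x y, x = y} -> (#|C| <= 2)%N.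
  move=> u; rewrite (cardsD1 j) -[2%N]/(1 + 1)%N leq_add ?leq_b1 //.
  by apply/card_le1_eqP => x y xC yC; apply: u.
case: cut => [cut|[j ej cut]].
  have AS : A \subset S.
    by apply/subsetP => i; rewrite !inE => /andP[ei]; rewrite ei cut.
  have B0 : B = set0.
    apply/setP => i; rewrite !inE; case: (boolP (excluded _ _ _ _ _)) => //= ei.
    by rewrite cut // subrr ltxx.
  by rewrite B0 setI0 cards0 (leq_trans _ S2) ?subset_leq_card.
have Aj i : i \in A -> i != j -> i \in S /\ (c i <= c j)%N.
  rewrite !inE => /andP[ei /andP[L0 Ld]] ij; rewrite ei.
  by case: (cut i ei ij) => -[LE' cij]; move: L0 Ld; rewrite LE' ?ltxx // => -> ->.
have Bj i : i \in B -> i != j -> i \in S /\ (c j <= c i)%N.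
  rewrite !inE => /andP[ei /andP[L0 Ld]] ij; rewrite ei.
  case: (cut i ei ij) => -[LE' cij]; move: L0 Ld;
    rewrite LE' ?subr0 ?subrr ?ltxx //.
  by move=> -> ->.
have cj2 : c j = 2%N \/ (c j <= 1)%N.
  by have := cN j ej; case: ifP => _ => [[]|] ->; [right|left|right].
split.
- apply: (card1 j) => x y.
  suff cA z : z \in A :\ j -> c z = 0%N by move=> /cA cx /cA; exact: c0.
  (* A member of class 2 ahead of the cut would force the cut into class 2 and thus coincide with
     it. *)
  rewrite in_setD1 => /andP[zj /Aj/(_ zj)[/cS[//|cz] czj]].
  case: cj2 => cj; first by rewrite (c2u _ _ cz cj) eqxx in zj.
  by have := leq_trans czj cj; rewrite cz.
- apply: (card1 j) => x y.
  suff cB z : z \in B :\ j -> c z = 2%N by move=> /cB cx /cB; exact: c2u.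
  rewrite in_setD1 => /andP[zj /Bj/(_ zj)[/cS[cz|//] czj]].
  have /c0/(_ cz) jz : c j = 0%N by apply/eqP; rewrite -leqn0 -cz.
  by rewrite jz eqxx in zj.
- rewrite -(cards1 j); apply/subset_leq_card/subsetP => i; rewrite !inE.
  move=> /andP[/andP[ei /andP[L0 _]] /andP[_ /andP[aL0 _]]].
  apply: contraTT aL0 => ij.
  by case: (cut i ei ij) L0 => -[-> _]; rewrite ?subrr ltxx.
Qed.
End GreedySplit.

(** * Flows through the nodes of an sp-tree *)

Section Flow.
Variables (R : realFieldType) (G : digraph) (I : multiflow_instance R G).
Implicit Types (X Y : 'M[R]_(na G, nk I)) (w l r T : sptree 'I_(na G)).
Implicit Types (i : 'I_(nk I)) (v : 'I_(nv G)).

Definition flow Y w i : R :=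
  \sum_(e in arcs (subdig w) | arc_tail e == startn (subdig w)) Y e i.

Definition outflow Y w i : R :=
  \sum_(e in arcs (subdig w) | arc_head e == endn (subdig w)) Y e i.

Definition local_net Y w v i : R :=
  \sum_(e in arcs (subdig w) | arc_tail e == v) Y e i
  - \sum_(e in arcs (subdig w) | arc_head e == v) Y e i.

Lemma sum_disjointU (J : finType) (A B : {set J}) (P : pred J) (f : J -> R) :
  [disjoint A & B] ->
  \sum_(e in A :|: B | P e) f e
  = \sum_(e in A | P e) f e + \sum_(e in B | P e) f e.
Proof.
move=> dAB; rewrite !big_mkcondr -bigU //=.
by apply: eq_bigl => e; rewrite !inE.
Qed.

Lemma sum_tail0 Y w v i :
  (forall e, e \in arcs (subdig w) -> arc_tail e != v) ->
  \sum_(e in arcs (subdig w) | arc_tail e == v) Y e i = 0.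
Proof.
by move=> nv; rewrite big1// => e /andP[/nv/negPf->].
Qed.

Lemma sum_head0 Y w v i :
  (forall e, e \in arcs (subdig w) -> arc_head e != v) ->
  \sum_(e in arcs (subdig w) | arc_head e == v) Y e i = 0.
Proof.
by move=> nv; rewrite big1// => e /andP[/nv/negPf->].
Qed.

(** Net flow is additive over both compositions. Reading [flow] and [outflow] as net flows at the
    two ends turns their composition rules into instances of this additivity. *)
Lemma local_net_start Y w i : sp_decomposition w ->
  local_net Y w (startn (subdig w)) i = flow Y w i.
Proof.
by move=> /sp_decomposition_ends[_ _ _ a];
  rewrite /local_net sum_head0 ?subr0// => e /a[].
Qed.

Lemma local_net_end Y w i : sp_decomposition w ->
  local_net Y w (endn (subdig w)) i = - outflow Y w i.
Proof.
by move=> /sp_decomposition_ends[_ _ _ a];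
  rewrite /local_net sum_tail0 ?sub0r// => e /a[].
Qed.

Lemma local_net_series Y l r v i : sp_decomposition (SNode l r) ->
  local_net Y (SNode l r) v i = local_net Y l v i + local_net Y r v i.
Proof. by case=> _ _ [d _ _]; rewrite /local_net /= !sum_disjointU//; lra. Qed.

Lemma local_net_parallel Y l r v i : sp_decomposition (PNode l r) ->
  local_net Y (PNode l r) v i = local_net Y l v i + local_net Y r v i.
Proof. by case=> _ _ [d _ _ _]; rewrite /local_net /= !sum_disjointU//; lra. Qed.

Lemma local_net_out Y w v i : sp_decomposition w ->
  v \notin verts (subdig w) -> local_net Y w v i = 0.
Proof.
move=> /sp_decomposition_ends[_ _ _ a] nv.
by rewrite /local_net sum_tail0 ?sum_head0 ?subr0// => e /a[? ? _ _];
  apply: contraNneq nv => <-.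
Qed.

Lemma series_startn_notin l r : sp_decomposition (SNode l r) ->
  startn (subdig l) \notin verts (subdig r).
Proof.
case=> /sp_decomposition_ends[nl sl _ _] _ [_ _ /setP/(_ (startn (subdig l)))].
by rewrite !inE sl (negPf nl) => /= ->.
Qed.

Lemma series_endn_notin l r : sp_decomposition (SNode l r) ->
  endn (subdig r) \notin verts (subdig l).
Proof.
case=> _ /sp_decomposition_ends[nr _ er _] [_ mE /setP/(_ (endn (subdig r)))].
by rewrite !inE er mE eq_sym (negPf nr) andbT => /= ->.
Qed.

Lemma flow_series Y l r i : sp_decomposition (SNode l r) ->
  flow Y (SNode l r) i = flow Y l i.
Proof.
move=> sp; have [spl spr _] := sp.
rewrite -local_net_start// local_net_series//= local_net_start//.
by rewrite local_net_out ?addr0// series_startn_notin.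
Qed.

Lemma outflow_series Y l r i : sp_decomposition (SNode l r) ->
  outflow Y (SNode l r) i = outflow Y r i.
Proof.
move=> sp; have [spl spr _] := sp; apply: oppr_inj.
rewrite -local_net_end// local_net_series//= -[in RHS]local_net_end//.
by rewrite local_net_out ?add0r// series_endn_notin.
Qed.

Lemma flow_parallel Y l r i : sp_decomposition (PNode l r) ->
  flow Y (PNode l r) i = flow Y l i + flow Y r i.
Proof.
move=> sp; have [spl spr [_ sE _ _]] := sp.
by rewrite -local_net_start// local_net_parallel//= local_net_start//
  sE local_net_start.
Qed.

Lemma outflow_parallel Y l r i : sp_decomposition (PNode l r) ->
  outflow Y (PNode l r) i = outflow Y l i + outflow Y r i.
Proof.
move=> sp; have [spl spr [_ _ eE _]] := sp; apply: oppr_inj.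
by rewrite -local_net_end// local_net_parallel//= local_net_end// eE
  local_net_end// opprD.
Qed.

(** * Conservation and demand bounds inside a subdigraph *)

Variable X : 'M[R]_(na G, nk I).
Hypothesis X_flow : is_multiflow X.

Lemma flow_ge0 w i : 0 <= flow X w i.
Proof. by apply: sumr_ge0 => e _; case: X_flow. Qed.

Lemma outflow_ge0 w i : 0 <= outflow X w i.
Proof. by apply: sumr_ge0 => e _; case: X_flow. Qed.

Definition supply i v : R := dem i * (src i == v)%:R.
Definition consumption i v : R := dem i * (snk i == v)%:R.
Definition inner_supply w i : R := dem i * (src i \in inner w)%:R.
Definition inner_consumption w i : R := dem i * (snk i \in inner w)%:R.

(** Writing the right-hand side as a difference of two indicator terms is possible because source
    and sink differ; it makes the balance linear. *)
Lemma local_net_inner w v i : closed_at w -> v \in inner w ->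
  local_net X w v i = supply i v - consumption i v.
Proof.
move=> cl vi; have [_ /(_ v i)] := X_flow.
rewrite /net_outflow /supply /consumption /local_net => e.
transitivity (\sum_(e | arc_tail e == v) X e i - \sum_(e | arc_head e == v) X e i).
  by congr (_ - _); apply: eq_bigl => f; apply: andb_idl => fv; apply: (cl v) => //;
    rewrite fv ?orbT.
rewrite e ![v == _]eq_sym; have /eqP nst := @src_neq_snk _ _ I i.
case: (src i =P v) => [<-|_]; last by case: (_ == v); rewrite ?mulr0 ?mulr1; lra.
by rewrite eq_sym (negPf nst) /= ?mulr0 mulr1 subr0.
Qed.

Lemma inner_supply_series l r i : sp_decomposition (SNode l r) ->
  inner_supply (SNode l r) i
  = inner_supply l i + supply i (endn (subdig l)) + inner_supply r i.
Proof. by move=> sp; rewrite /inner_supply inner_series // !natrD !mulrDr. Qed.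

Lemma inner_consumption_series l r i : sp_decomposition (SNode l r) ->
  inner_consumption (SNode l r) i
  = inner_consumption l i + consumption i (endn (subdig l)) + inner_consumption r i.
Proof. by move=> sp; rewrite /inner_consumption inner_series // !natrD !mulrDr. Qed.

Lemma inner_supply_parallel l r i : sp_decomposition (PNode l r) ->
  inner_supply (PNode l r) i = inner_supply l i + inner_supply r i.
Proof. by move=> sp; rewrite /inner_supply inner_parallel // !natrD !mulrDr. Qed.

Lemma inner_consumption_parallel l r i : sp_decomposition (PNode l r) ->
  inner_consumption (PNode l r) i = inner_consumption l i + inner_consumption r i.
Proof. by move=> sp;
  rewrite /inner_consumption inner_parallel // !natrD !mulrDr. Qed.

Lemma flow_middle l r i : sp_decomposition (SNode l r) -> closed_at (SNode l r) ->
  flow X r i + consumption i (endn (subdig l))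
  = outflow X l i + supply i (endn (subdig l)).
Proof.
move=> sp cl; have [spl spr [_ mE _]] := sp.
have mi : endn (subdig l) \in inner (SNode l r).
  by rewrite -[_ \in _]lt0b inner_series // eqxx addnAC addnC.
have := local_net_inner i cl mi; rewrite local_net_series // local_net_end //.
by rewrite [in local_net X r _ i]mE local_net_start //; lra.
Qed.

(** This is conservation summed over the inner nodes, obtained along the tree: a leaf has no inner
    node, and [flow_middle] joins the two halves of a series composition. *)
Lemma flow_balance w i : sp_decomposition w -> closed_at w ->
  outflow X w i + inner_consumption w i = flow X w i + inner_supply w i.
Proof.
elim: w => [e|l IHl r IHr|l IHl r IHr].
- move=> _ _;
    have inner0 v : (v \in inner (QNode e)) = false by rewrite /inner /= setDv inE.
  rewrite /inner_supply /inner_consumption !inner0 !mulr0 !addr0.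
  by rewrite /outflow /flow !big_mkcondr /= !big_set1 !eqxx.
- move=> sp cl; have [spl spr _] := sp; have [cll clr] := closed_at_series sp cl.
  rewrite outflow_series // flow_series // inner_supply_series //.
  rewrite inner_consumption_series //.
  have := flow_middle i sp cl; have := IHl spl cll; have := IHr spr clr; lra.
- move=> sp cl; have [spl spr _] := sp; have [cll clr] := closed_at_parallel sp cl.
  rewrite outflow_parallel // flow_parallel // inner_supply_parallel //.
  rewrite inner_consumption_parallel //.
  have := IHl spl cll; have := IHr spr clr; lra.
Qed.

Lemma inner_supply_ge0 w i : 0 <= inner_supply w i.
Proof. by rewrite mulr_ge0 ?ler0n// ltW ?dem_gt0. Qed.

Lemma inner_consumption_ge0 w i : 0 <= inner_consumption w i.
Proof. by rewrite mulr_ge0 ?ler0n// ltW ?dem_gt0. Qed.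

(* Acyclicity of G enters the proof only through this bound, which passes from a
   node to its children. *)
Definition within_demand w : Prop :=
  forall i, flow X w i + inner_supply w i <= dem i.

(** What enters the right child has come through the left child or from a source there or at the
    middle node, so it is already accounted for in the bound of the parent. *)
Lemma within_demand_series l r : sp_decomposition (SNode l r) ->
  closed_at (SNode l r) -> within_demand (SNode l r) ->
  within_demand l /\ within_demand r.
Proof.
move=> sp cl wd; have [spl _ _] := sp; have [cll _] := closed_at_series sp cl.
have s0 i v : 0 <= supply i v by rewrite mulr_ge0 ?ler0n// ltW ?dem_gt0.
have c0 i v : 0 <= consumption i v by rewrite mulr_ge0 ?ler0n// ltW ?dem_gt0.
split=> i; have := wd i; rewrite flow_series // inner_supply_series //.
  by have := inner_supply_ge0 r i; have := s0 i (endn (subdig l)); lra.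
have := flow_middle i sp cl; have := flow_balance i spl cll.
by have := inner_consumption_ge0 l i; have := c0 i (endn (subdig l)); lra.
Qed.

Lemma within_demand_parallel l r : sp_decomposition (PNode l r) ->
  within_demand (PNode l r) -> within_demand l /\ within_demand r.
Proof.
move=> sp wd.
split=> i; have := wd i; rewrite flow_parallel // inner_supply_parallel //;
by have := inner_supply_ge0 l i; have := inner_supply_ge0 r i;
   have := flow_ge0 l i; have := flow_ge0 r i; lra.
Qed.

Lemma is_sptree_sp T : is_sptree T -> sp_decomposition T. Proof. by case. Qed.

Lemma closed_at_root T : is_sptree T -> closed_at T.
Proof. by case=> _ _ aT v _ e _; rewrite aT inE. Qed.

Lemma local_net_root Y T v i : is_sptree T -> local_net Y T v i = net_outflow Y v i.
Proof.
by case=> _ _ aT; rewrite /local_net /net_outflow aT; congr (_ - _);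
  apply: eq_bigl => e; rewrite inE.
Qed.

Lemma flow_root T i : is_sptree T -> flow X T i = supply i (startn (subdig T)).
Proof.
move=> sT; have sp := is_sptree_sp sT.
have := local_net_start X i sp; rewrite local_net_root // => <-.
have := local_net_start X i sp; rewrite local_net_root //.
case: X_flow => _ ->; rewrite /supply ![_ == src i]eq_sym.
case: eqP => [_ _|_]; first by rewrite mulr1.
(* A sink at the start node would need a negative net outflow there, although no arc enters that
   node. *)
rewrite mulr0; case: eqP => // _ f.
by have := flow_ge0 T i; have := dem_gt0 i; lra.
Qed.

(** A source may be the start node or an inner node, but not both, so the two indicators add up to
    at most one. *)
Lemma within_demand_root T : is_sptree T -> within_demand T.
Proof.
move=> sT i; rewrite flow_root // /supply /inner_supply -mulrDr.
rewrite -[leRHS]mulr1 ler_pM2l ?dem_gt0 // -natrD lern1.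
by rewrite !inE; case: (_ == startn _) => //=; case: (_ && _).
Qed.

Definition passing w i : bool := inner w :&: [set src i; snk i] == set0.

Lemma passingE w i :
  passing w i = (src i \notin inner w) && (snk i \notin inner w).
Proof.
by rewrite /passing setI_eq0 disjoints_subset setCU subsetI -!disjoints_subset
  ![[disjoint inner w & _]]disjoint_sym !disjoints1.
Qed.

(** With an inner source, [within_demand] leaves no room for flow from outside, and the outflow
    depends on whether the sink is inner too. With only the sink inside, the balance asks for at
    least the demand and the bound allows no more. *)
Lemma not_passing_transit w i :
  sp_decomposition w -> closed_at w -> within_demand w -> ~~ passing w i ->
  flow X w i = 0 /\ (outflow X w i = 0 \/ outflow X w i = dem i) \/
  [/\ flow X w i = dem i, outflow X w i = 0 & inner_consumption w i = dem i].
Proof.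
move=> sp cl wd; rewrite passingE negb_and !negbK.
have := flow_balance i sp cl; have := wd i; have := flow_ge0 w i.
have := outflow_ge0 w i; rewrite /inner_supply /inner_consumption.
case: (src i \in _); case: (snk i \in _); rewrite ?mulr1 ?mulr0 //= => ? ? ? ? _.
- by left; split; [|left]; lra.
- by left; split; [|right]; lra.
- by right; split; lra.
Qed.

Lemma passing_transit w i :
  sp_decomposition w -> closed_at w -> passing w i -> outflow X w i = flow X w i.
Proof.
move=> sp cl; rewrite passingE => /andP[/negPf si /negPf ti].
by have := flow_balance i sp cl;
  rewrite /inner_supply /inner_consumption si ti mulr0 !addr0.
Qed.

Lemma mem_inner_series l r v : sp_decomposition (SNode l r) ->
  (v \in inner (SNode l r))
  = [|| v \in inner l, v == endn (subdig l) | v \in inner r].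
Proof.
by move=> sp; rewrite -[LHS]lt0b inner_series // !addn_gt0 !lt0b orbA.
Qed.

Lemma mem_inner_parallel l r v : sp_decomposition (PNode l r) ->
  (v \in inner (PNode l r)) = (v \in inner l) || (v \in inner r).
Proof. by move=> sp; rewrite -[LHS]lt0b inner_parallel // addn_gt0 !lt0b. Qed.

Lemma passing_series l r i : sp_decomposition (SNode l r) ->
  passing (SNode l r) i ->
  [/\ passing l i, passing r i, src i != endn (subdig l) & snk i != endn (subdig
    l)].
Proof.
move=> sp; rewrite !passingE !mem_inner_series // !negb_or.
by move=> /andP[/and3P[-> -> ->] /and3P[-> -> ->]].
Qed.

Lemma passing_parallel l r i : sp_decomposition (PNode l r) ->
  passing (PNode l r) i = passing l i && passing r i.
Proof.
by move=> sp; rewrite !passingE !mem_inner_parallel // !negb_or andbACA.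
Qed.

(** * Amounts prescribed at a node and multiflows realizing them *)

Implicit Types (a b : 'I_(nk I) -> R).

(** Lets fractional commodities be counted for prescribed amounts, before any multiflow carrying
    them exists. *)
Definition fractional_at w a : {set 'I_(nk I)} :=
  [set i | passing w i && (0 < a i < dem i)].

Lemma fractional_flow Y w a :
  (forall i, flow Y w i = a i) -> fractional Y w = fractional_at w a.
Proof.
move=> fa; apply/setP => i; rewrite !inE /demand_share -/(flow Y w i) fa /passing.
case: (_ == set0) => /=; last by rewrite ltxx andbF.
by rewrite pmulr_lgt0 ?invr_gt0 ?dem_gt0 // ltr_pdivrMr ?dem_gt0 // mul1r.
Qed.

(** The invariant handed down the tree. Only the sum over all commodities has to agree with [X]; at
    a leaf this is the preservation of total flow. *)
Definition admissible w a : Prop :=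
  [/\ forall i, 0 <= a i <= dem i,
      \sum_i a i = \sum_i flow X w i,
      forall i, ~~ passing w i -> a i = flow X w i
    & (#|fractional_at w a| <= 2)%N].

Lemma flow_le_dem w i : within_demand w -> flow X w i <= dem i.
Proof. by move=> wd; have := wd i; have := inner_supply_ge0 w i; lra. Qed.

Lemma admissible_root T : is_sptree T -> admissible T (flow X T).
Proof.
move=> sT; have wd := within_demand_root sT; split=> //.
  by move=> i; rewrite flow_ge0 flow_le_dem.
rewrite (_ : fractional_at _ _ = set0) ?cards0 //.
apply/setP => i; rewrite !inE flow_root // /supply.
by case: (_ == _); rewrite ?mulr1 ?mulr0 ltxx ?andbF.
Qed.

(** One formula serves both kinds of commodities at the right child: if [i] passes the s-node, its
    two flows in [X] agree and the value is [a i]; otherwise [a i] is [flow X l i] and the value is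
    [flow X r i]. *)
Lemma admissible_series l r a :
  sp_decomposition (SNode l r) -> closed_at (SNode l r) ->
  within_demand (SNode l r) -> admissible (SNode l r) a ->
  admissible l a /\ admissible r (fun i => flow X r i + a i - flow X l i).
Proof.
move=> sp cl wd [a0 aS aE aF]; have [spl spr _] := sp.
have [cll clr] := closed_at_series sp cl.
have [wdl wdr] := within_demand_series sp cl wd.
have aP i : passing (SNode l r) i -> flow X r i = flow X l i.
  move=> /(passing_series sp)[pl pr /negPf sm /negPf tm].
  have := flow_middle i sp cl; rewrite /supply /consumption sm tm !mulr0 !addr0.
  by rewrite (passing_transit spl cll pl).
have aN i : ~~ passing (SNode l r) i -> a i = flow X l i.
  by move=> /aE ->; rewrite flow_series.
have pl i : ~~ passing l i -> ~~ passing (SNode l r) i.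
  by apply: contraNN => /(passing_series sp)[].
have pr i : ~~ passing r i -> ~~ passing (SNode l r) i.
  by apply: contraNN => /(passing_series sp)[].
have fl i : ~~ passing (SNode l r) i -> (0 < a i < dem i) = false.
  move=> np; rewrite aE //.
  by case: (not_passing_transit sp cl wd np) => [[-> _]|[-> _ _]];
    rewrite ltxx ?andbF.
split; split.
- exact: a0.
- by rewrite aS; apply: eq_bigr => i _; rewrite flow_series.
- by move=> i /pl/aN.
- apply: leq_trans aF; apply/subset_leq_card/subsetP => i; rewrite !inE.
  by case/andP=> _ ai; rewrite ai andbT; apply: contraTT ai => /fl ->.
- move=> i; have [p|np] := boolP (passing (SNode l r) i).
    by rewrite aP //; have := a0 i; lra.
  by rewrite aN // addrK flow_ge0 flow_le_dem.
- rewrite sumrB big_split /= aS;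
    under [X in _ + X - _]eq_bigr do rewrite flow_series //.
  by rewrite addrK.
- by move=> i /pr/aN ->; rewrite addrK.
- apply: leq_trans aF; apply/subset_leq_card/subsetP => i; rewrite !inE.
  have [p|np] := boolP (passing (SNode l r) i).
    by rewrite aP // addrAC subrr add0r => /andP[].
  rewrite aN // addrK => /andP[pri].
  (* A commodity that passes the right child but not the s-node leaves both in the same amount,
     which is zero or its demand. *)
  rewrite -(passing_transit spr clr pri) -(outflow_series X i sp).
  by case: (not_passing_transit sp cl wd np) => [[_ [->|->]]|[_ -> _]];
    rewrite ltxx ?andbF.
Qed.


Local Notation demand := (@dem R G I).

(** If anything enters, it is the whole demand heading for an inner sink; the balance of the child
    containing that sink shows that all of it enters this child. *)
Lemma not_passing_excluded l r a i :
  sp_decomposition (PNode l r) -> closed_at (PNode l r) ->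
  within_demand (PNode l r) -> a i = flow X (PNode l r) i ->
  ~~ passing (PNode l r) i ->
  a i = 0 \/ excluded (flow X l) (flow X r) a demand i.
Proof.
move=> sp cl wd aE np; have [spl spr _] := sp.
have [cll clr] := closed_at_parallel sp cl.
case: (not_passing_transit sp cl wd np) => [[f0 _]|[fd od cd]]; first by left;
  rewrite aE.
right; rewrite /excluded aE fd lexx /=.
have := flow_balance i sp cl; rewrite od cd fd inner_supply_parallel // => sw.
have := inner_consumption_parallel i sp; rewrite cd => cw.
have bl := flow_balance i spl cll; have br := flow_balance i spr clr.
have := outflow_ge0 l i; have := outflow_ge0 r i.
have := inner_supply_ge0 l i; have := inner_supply_ge0 r i => s1 s2 o1 o2.
have : inner_consumption l i = demand i \/ inner_consumption l i = 0.
  by rewrite /inner_consumption; case: (_ \in _); [left|right];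
    rewrite ?mulr1 ?mulr0.
by case=> c; apply/orP; [left|right]; lra.
Qed.

Lemma admissible_parallel l r a c L :
  sp_decomposition (PNode l r) -> closed_at (PNode l r) ->
  within_demand (PNode l r) -> admissible (PNode l r) a ->
  classifies (flow X l) (flow X r) a demand c ->
  greedy_split (flow X l) (flow X r) a demand c L ->
  [/\ admissible l L, admissible r (fun i => a i - L i) &
      (#|fractional_at l L :&: fractional_at r (fun i => (a i - L i)%R)| <= 1)%N].
Proof.
move=> sp cl wd [a0 aS aE aF] cP LP; have [spl spr _] := sp.
have [cll clr] := closed_at_parallel sp cl.
have [wdl wdr] := within_demand_parallel sp wd.
have flow_sum i : flow X l i + flow X r i <= demand i.
  by rewrite -flow_parallel //; exact: flow_le_dem.
(* The two flows of [X] add up to at most the demand, so an excluded commodity uses one side wholly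
   and the other not at all. *)
have ex i : excluded (flow X l) (flow X r) a demand i ->
    [/\ a i = demand i, flow X l i = 0 \/ flow X l i = demand i
      & flow X r i = demand i - flow X l i].
  move=> /andP[da]; have := a0 i; have := flow_sum i.
  have := flow_ge0 l i; have := flow_ge0 r i => r0 l0 lr /andP[_ ad] /orP[] f.
    by split; [|right|]; lra.
  by split; [|left|]; lra.
have fP i : 0 < a i < demand i -> passing (PNode l r) i.
  apply: contraTT => np; rewrite aE //.
  by case: (not_passing_transit sp cl wd np) => [[-> _]|[-> _ _]];
    rewrite ltxx ?andbF.
have [] := greedy_split_card cP LP.
  apply: leq_trans aF; apply/subset_leq_card/subsetP => i;
    rewrite !inE => /andP[_ ai].
  by rewrite ai fP.
case: LP => LE La LS _.
set A := [set i | _ & _]; set B := [set i | _ & _] => A2 B2 AB.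
have subA : fractional_at l L \subset A.
  apply/subsetP => i; rewrite !inE => /andP[_ Li]; rewrite Li andbT.
  apply: contraTN Li => ei; rewrite LE //.
  by case: (ex i ei) => _ [->|->] _; rewrite ltxx ?andbF.
have subB : fractional_at r (fun i => a i - L i) \subset B.
  apply/subsetP => i; rewrite !inE => /andP[_ Li]; rewrite Li andbT.
  apply: contraTN Li => ei; rewrite LE //.
  by case: (ex i ei) => -> [->|->] _; rewrite ?subrr ?subr0 ltxx ?andbF.
(* A commodity that neither passes nor is excluded has amount zero, which leaves nothing to
   choose. *)
have npE i : ~~ passing (PNode l r) i -> L i = flow X l i.
  move=> np; have [ei|ei] := boolP (excluded (flow X l) (flow X r) a demand i).
    exact: LE.
  have := @not_passing_excluded l r a i sp cl wd (aE i np) np.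
  rewrite (negPf ei) => -[] // ai; have := aE i np; rewrite flow_parallel //.
  by have := La i; have := flow_ge0 l i; have := flow_ge0 r i; lra.
split; last first.
- by apply: leq_trans AB; apply/subset_leq_card/setISS.
- split.
  + by move=> i; have := La i; have := a0 i; lra.
  + rewrite sumrB aS LS; under eq_bigr do rewrite flow_parallel //.
    by rewrite big_split /= addrAC subrr add0r.
  + move=> i nr; have np : ~~ passing (PNode l r) i.
      by rewrite passing_parallel // negb_and nr orbT.
    by rewrite npE // aE // flow_parallel // addrAC subrr add0r.
  + exact: leq_trans (subset_leq_card subB) B2.
- split=> //.
  + by move=> i; have := La i; have := a0 i; lra.
  + by move=> i nl; apply: npE; rewrite passing_parallel // negb_and nl.
  + exact: leq_trans (subset_leq_card subA) A2.
Qed.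

(** The net-flow clause says that [Y] deviates from [X] by a flow of value [a i - flow X w i] from
    start to end. Inner nodes are undisturbed, and at the root, where this value is zero,
    conservation for [Y] follows from that for [X]. *)
Definition realizes w a Y : Prop :=
  [/\ forall i, flow Y w i = a i,
      forall e, e \in arcs (subdig w) -> forall i, 0 <= Y e i,
      forall e, e \in arcs (subdig w) -> total_flow Y e = total_flow X e,
      forall v i, local_net Y w v i - local_net X w v i
        = (a i - flow X w i)
          * ((v == startn (subdig w))%:R - (v == endn (subdig w))%:R)
    & almost_unsplittable w Y].

Lemma flow_leaf Y e i : flow Y (QNode e) i = Y e i.
Proof. by rewrite /flow big_mkcondr /= big_set1 eqxx. Qed.

Lemma realizes_leaf e a Y :
  admissible (QNode e) a -> (forall i, Y e i = a i) -> realizes (QNode e) a Y.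
Proof.
move=> [a0 aS aE aF] Ya; have fa i : flow Y (QNode e) i = a i by rewrite flow_leaf.
split=> //.
- by move=> f; rewrite inE => /eqP-> i; rewrite Ya; have /andP[] := a0 i.
- move=> f; rewrite inE => /eqP->; rewrite /total_flow.
  by under eq_bigr do rewrite Ya; rewrite aS; apply: eq_bigr => i _;
    rewrite flow_leaf.
- move=> v i; rewrite /local_net !big_mkcondr /= !big_set1 Ya flow_leaf.
  by rewrite ![arc_tail e == _]eq_sym ![arc_head e == _]eq_sym;
    case: (v == _); case: (v == _) => /=; rewrite ?mulr0n ?mulr1n; lra.
- split=> /=; last by move=> ? ? [].
  by move=> w [->|//]; rewrite (fractional_flow fa).
Qed.

Lemma realizes_series l r a Y :
  sp_decomposition (SNode l r) -> closed_at (SNode l r) ->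
  admissible (SNode l r) a -> realizes l a Y ->
  realizes r (fun i => flow X r i + a i - flow X l i) Y ->
  realizes (SNode l r) a Y.
Proof.
move=> sp cl [_ _ _ aF] [fl Yl tl nl [al al']] [fr Yr tr nr [ar ar']].
have fa i : flow Y (SNode l r) i = a i by rewrite flow_series.
have [_ _ [_ mE _]] := sp.
split=> //.
- by move=> e; rewrite inE => /orP[/Yl|/Yr].
- by move=> e; rewrite inE => /orP[/tl|/tr].
(* Both children deviate by the same value, so the contributions at the middle node cancel. *)
- move=> v i; rewrite !local_net_series // flow_series //.
  by have := nl v i; have := nr v i; rewrite /= mE; lra.
- split=> /= [w [->|[/al|/ar]//]|w1 w2 [//|[/al'|/ar']//]].
  by rewrite (fractional_flow fa).
Qed.

Lemma realizes_parallel l r a L Y :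
  sp_decomposition (PNode l r) -> closed_at (PNode l r) ->
  admissible (PNode l r) a ->
  (#|fractional_at l L :&: fractional_at r (fun i => (a i - L i)%R)| <= 1)%N ->
  realizes l L Y -> realizes r (fun i => a i - L i) Y ->
  realizes (PNode l r) a Y.
Proof.
move=> sp cl [_ _ _ aF] fLR [fl Yl tl nl [al al']] [fr Yr tr nr [ar ar']].
have fa i : flow Y (PNode l r) i = a i by rewrite flow_parallel // fl fr; lra.
have [_ _ [_ sE eE _]] := sp.
split=> //.
- by move=> e; rewrite inE => /orP[/Yl|/Yr].
- by move=> e; rewrite inE => /orP[/tl|/tr].
- move=> v i; rewrite !local_net_parallel // flow_parallel //.
  by have := nl v i; have := nr v i; rewrite /= sE eE; lra.
- split=> /= [w [->|[/al|/ar]//]|w1 w2 [[-> ->]|[/al'|/ar']//]].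
    by rewrite (fractional_flow fa).
  by rewrite (fractional_flow fl) (fractional_flow fr).
Qed.

Lemma arcs_node_of w T : node_of w T -> arcs (subdig w) \subset arcs (subdig T).
Proof.
elim: T => [e|l IHl r IHr|l IHl r IHr] /= [->|] //.
  by case=> [/IHl|/IHr] s; apply: subset_trans s _; rewrite ?subsetUl ?subsetUr.
by case=> [/IHl|/IHr] s; apply: subset_trans s _; rewrite ?subsetUl ?subsetUr.
Qed.

Lemma eq_flow w Y Y' i :
  (forall e, e \in arcs (subdig w) -> Y e i = Y' e i) -> flow Y w i = flow Y' w i.
Proof. by move=> YY'; apply: eq_bigr => e /andP[/YY'->]. Qed.

Lemma node_of_parallel w1 w2 T :
  node_of (PNode w1 w2) T -> node_of w1 T /\ node_of w2 T.
Proof.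
have refl w : node_of w w by case: w => *; left.
elim: T => [e|l IHl r IHr|l IHl r IHr] /= [] //.
- by case=> [/IHl|/IHr] []; split; right; [left|left|right|right].
- by case=> -> ->; split; right; [left|right].
- by case=> [/IHl|/IHr] []; split; right; [left|left|right|right].
Qed.

(** Keeps the result for one child valid while the arcs of its sibling are being written. *)
Lemma realizes_ext w a Y Y' :
  (forall e i, e \in arcs (subdig w) -> Y e i = Y' e i) ->
  realizes w a Y -> realizes w a Y'.
Proof.
move=> YY' [fY Y0 tY nY [aY aY']]; split.
- by move=> i; rewrite -fY; apply/esym/eq_flow => e; exact: YY'.
- by move=> e ew i; rewrite -YY' // Y0.
- by move=> e ew; rewrite -tY //; apply: eq_bigr => i _; rewrite YY'.
- move=> v i; rewrite -nY /local_net; congr (_ - _ - _);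
    by apply: eq_bigr => e /andP[ew _]; rewrite YY'.
- have fr w' : node_of w' w -> fractional Y w' = fractional Y' w'.
    move=> /arcs_node_of/subsetP sub.
    rewrite (@fractional_flow Y w' (flow Y w')) //; apply/esym/fractional_flow => i.
    by apply/esym/eq_flow => e /sub; exact: YY'.
  split=> [w' n|w1 w2 n]; first by rewrite -fr // aY.
  by have [n1 n2] := node_of_parallel n; rewrite -!fr // aY'.
Qed.

Lemma realizes_root T Y : is_sptree T -> realizes T (flow X T) Y ->
  [/\ is_multiflow Y, forall e, total_flow Y e = total_flow X e
    & almost_unsplittable T Y].
Proof.
move=> sT [fY Y0 tY nY aY]; have [_ _ aT] := sT.
have inT e : e \in arcs (subdig T) by rewrite aT inE.
split=> // [|e]; last exact: tY.
split=> [e i|v i]; first exact: Y0.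
have := nY v i; rewrite subrr mul0r !local_net_root // => /eqP;
  rewrite subr_eq0 => /eqP->.
by case: X_flow.
Qed.
End Flow.

(** * The greedy split, one commodity at a time *)

Section Classify.
Variables (R : realFieldType) (n : nat) (f g a d : 'I_n -> R).
Implicit Types (i j : 'I_n) (c : 'I_n -> nat) (x : R).

Lemma classifies_le2 c i :
  classifies f g a d c -> (c i <= 2)%N = ~~ excluded f g a d i.
Proof.
case=> c3 cN _ _; apply/idP/idP => [|/cN]; first by apply: contraL => /c3->.
by case: ifP => _ => [[]|] ->.
Qed.

(** [next] is 0 until the first fractional commodity is met and 2 afterwards. [x] collects the
    capacity of the first side that is left to non-excluded commodities, the excluded ones keeping
    their [f i]. *)
Definition classify_inv (k : nat) c (next : nat) x : Prop :=
  [/\ x = \sum_(i < n | (i < k)%N && ~~ excluded f g a d i) f i,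
      forall i, (i < k)%N -> excluded f g a d i -> c i = 3%N,
      forall i, (i < k)%N -> ~~ excluded f g a d i ->
        if 0 < a i < d i then c i = 0%N \/ c i = 2%N else c i = 1%N,
      forall i j, (i < k)%N -> (j < k)%N -> c i = 0%N -> c j = 0%N -> i = j
    & next = 0%N /\ (forall i, (i < k)%N -> c i <> 0%N /\ c i <> 2%N) \/
      next = 2%N /\ exists2 i : 'I_n, (i < k)%N & c i = 0%N].

Lemma classify_inv0 c : classify_inv 0 c 0 0.
Proof. by split=> //; [rewrite big_pred0|left]. Qed.

Lemma classify_inv_step i c c' next x :
  classify_inv i c next x ->
  (forall j, j != i -> c' j = c j) ->
  c' i = (if excluded f g a d i then 3%N else if 0 < a i < d i then next else
    1%N) ->
  classify_inv i.+1 c'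
    (if ~~ excluded f g a d i && (0 < a i < d i) then 2%N else next)
    (if excluded f g a d i then x else x + f i).
Proof.
move=> [xE c3 cN c0 nx] c'E c'i.
have lt j : (j < i.+1)%N = (j < i)%N || (j == i) by rewrite ltnS leq_eqVlt orbC.
have ne j : (j < i)%N -> j != i by rewrite neq_ltn => ->.
have nextE : next = 0%N \/ next = 2%N by case: nx => [[]|[]]; [left|right].
split.
- have [ei|ei] := boolP (excluded f g a d i).
    rewrite xE; apply: eq_bigl => j; rewrite lt.
    by have [->|_] := eqVneq j i; rewrite ?orbF // ei !andbF.
  rewrite (bigD1 i) /=; last by rewrite ltnSn ei.
  rewrite addrC xE; congr (_ + _); apply: eq_bigl => j; rewrite lt.
  by have [->|_] := eqVneq j i; rewrite ?orbF ?andbT // ltnn andbF.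
- by move=> j; rewrite lt => /orP[ji|/eqP->] ej; rewrite ?c'i ?ej // c'E ?ne // c3.
- move=> j; rewrite lt => /orP[ji|/eqP->] ej; first by rewrite c'E ?ne //;
    exact: cN.
  by rewrite c'i (negPf ej); case: (0 < a i < d i).
(* Class 0 is handed to [i] only while [next] is 0, hence while that class is still empty. *)
- have i0 j : (j < i)%N -> c' i = 0%N -> c' j = 0%N -> False.
    move=> ji; rewrite c'i c'E ?ne //; case: ifP => // _; case: ifP => // _ n0 cj.
    by case: nx => [[_ /(_ j ji)[]]//|[]]; rewrite n0.
  move=> j k; rewrite !lt => /orP[ji|/eqP->] /orP[ki|/eqP->] // cj ck.
  + by move: cj ck; rewrite !c'E ?ne //; exact: c0.
  + by case: (i0 j).
  + by case: (i0 k).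
- case: ifP => [/andP[ei fi]|/negbT nf]; last first.
    case: nx => [[-> nx]|[-> [j ji cj]]]; [left|right]; split=> //.
      move=> j; rewrite lt => /orP[ji|/eqP->]; first by rewrite c'E ?ne //;
        exact: nx.
      rewrite c'i; move: nf; rewrite negb_and negbK.
      by case: (excluded _ _ _ _ _) => //= /negPf->.
    by exists j; rewrite ?c'E ?ne // lt ji.
  right; split=> //; case: nx => [[n0 _]|[_ [j ji cj]]].
    by exists i; rewrite ?ltnSn // c'i (negPf ei) fi.
  by exists j; rewrite ?c'E ?ne // lt ji.
Qed.

Lemma classify_inv_end c next x : classify_inv n c next x ->
  classifies f g a d c /\ x = \sum_(i | (c i <= 2)%N) f i.
Proof.
move=> [xE c3 cN c0 nx]; have cP : classifies f g a d c.
  split=> [i|i|i j|i ci]; [exact: c3|exact: cN|exact: c0|].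
  case: nx => [[_ /(_ i (ltn_ord i))[_ /(_ ci)]]//|[_ [j _ cj]]].
  by exists j.
by split=> //; rewrite xE; apply: eq_bigl => i; rewrite ltn_ord classifies_le2.
Qed.
End Classify.

(** * Filling the first side in class order *)

Section Greedy.
Variables (R : realFieldType) (n : nat) (f a : 'I_n -> R) (c : 'I_n -> nat).
Implicit Types (P : pred 'I_n) (L : 'I_n -> R) (x : R) (i j : 'I_n).

(* The commodities in [P] have been handled, and [x] is the capacity that is
   left on the first side. *)
Definition greedy_inv P L x : Prop :=
  [/\ 0 <= x,
      forall i, if P i then 0 <= L i <= a i else L i == f i,
      x + \sum_(i | P i) L i = \sum_(i | (c i <= 2)%N) f i
    & (forall i, P i -> L i = a i) \/
      (x = 0 /\ exists2 j, P j & forall i, P i -> i != j -> cut_at a L c i j)].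

Lemma greedy_inv_ext P P' L L' x :
  P =1 P' -> L =1 L' -> greedy_inv P L x -> greedy_inv P' L' x.
Proof.
move=> PP LL [x0 Lf S D]; split=> //.
- by move=> i; have := Lf i; rewrite PP LL.
- by rewrite -S; congr (_ + _); apply: eq_big => [i|i _]; rewrite ?PP ?LL.
- case: D => [D|[-> [j Pj D]]]; [left|right].
    by move=> i; rewrite -PP -LL; apply: D.
  split=> //; exists j; first by rewrite -PP.
  by move=> i; rewrite -PP /cut_at -LL => Pi ij; exact: D.
Qed.

Lemma greedy_inv0 x : (forall i, 0 <= f i) -> x = \sum_(i | (c i <= 2)%N) f i ->
  greedy_inv pred0 f x.
Proof.
move=> f0 ->; split=> //; [exact: sumr_ge0|by move=> i /=; rewrite eqxx
  |by rewrite [X in _ + X]big_pred0 ?addr0|by left].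
Qed.

(** The first commodity that does not fit takes the remaining capacity and becomes the cut; every
    later one receives zero. Taking commodities in order of class gives the comparisons required by
    [cut_at]. *)
Lemma greedy_inv_step P P' L L' x i :
  (forall i, 0 <= a i) -> greedy_inv P L x -> ~~ P i ->
  (forall j, P j -> (c j <= c i)%N) ->
  (forall j, P' j = P j || (j == i)) ->
  (forall j, j != i -> L' j = L j) ->
  L' i = (if a i <= x then a i else x) ->
  greedy_inv P' L' (x - L' i).
Proof.
move=> a0 [x0 Lf S D] Pi cle P'E L'E L'i.
have a0i := a0 i; have L'x : L' i <= x /\ 0 <= L' i <= a i by rewrite L'i;
  case: (leP (a i) x) => h; split; lra.
have neq j : P j -> j != i by move=> Pj; apply: contraNneq Pi => <-.
split.
- by rewrite subr_ge0; case: L'x.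
- move=> j; rewrite P'E; have [->|ji] := eqVneq j i; first by rewrite orbT;
    case: L'x.
  by rewrite orbF L'E //; exact: Lf.
- rewrite -S (bigD1 i) /=; last by rewrite P'E eqxx orbT.
  rewrite addrA subrK; congr (_ + _); apply: eq_big => j.
    rewrite P'E; have [->|ji] := eqVneq j i; first by rewrite (negPf Pi) andbF.
    by rewrite orbF andbT.
  by case/andP=> _ ji; rewrite L'E.
- case: D => [D|[xE [j Pj D]]].
    have [ax|xa] := leP (a i) x.
      left=> j; rewrite P'E => /orP[Pj|/eqP->]; last by rewrite L'i ax.
      by rewrite L'E ?neq // D.
    right; rewrite L'i leNgt xa /= subrr; split=> //.
    exists i => [|j]; first by rewrite P'E eqxx orbT.
    rewrite P'E => /orP[Pj|/eqP->]; last by rewrite eqxx.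
    by move=> ji; left; rewrite L'E // D // cle.
  right; have L'0 : L' i = 0 by rewrite L'i xE; case: ifP => // ai; have := a0 i;
    lra.
  split; first by rewrite L'0 subr0.
  exists j => [|k]; first by rewrite P'E Pj.
  rewrite P'E => /orP[Pk|/eqP->] kj; last by right; split; rewrite ?cle.
  by rewrite /cut_at !L'E ?neq //; exact: D.
Qed.

Lemma greedy_inv_split (g d : 'I_n -> R) L x :
  (forall i, 0 <= f i <= d i) -> (forall i, 0 <= g i) -> (forall i, a i <= d i) ->
  \sum_i a i = \sum_i (f i + g i) ->
  classifies f g a d c -> greedy_inv (fun i => c i <= 2)%N L x ->
  greedy_split f g a d c L.
Proof.
move=> f0 g0 ad aS cP [x0 Lf S D].
have cE i := classifies_le2 i cP.
(* Without a cut, all non-excluded amounts fit on the first side. Excluded ones satisfy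
   [a i <= f i + g i], so by equality of the totals the others amount to at least the capacity and
   exhaust it. *)
have xE : x = 0.
  case: D => [D|[]//].
  have : \sum_(i | (c i <= 2)%N) f i <= \sum_(i | (c i <= 2)%N) a i.
    have : \sum_(i | ~~ (c i <= 2)%N) a i <= \sum_(i | ~~ (c i <= 2)%N) (f i + g i).
      apply: ler_sum => i; rewrite cE negbK => /andP[_ /orP[]] di;
      by have := ad i; have := f0 i; have := g0 i; lra.
    have : \sum_(i | (c i <= 2)%N) (f i + g i) >= \sum_(i | (c i <= 2)%N) f i.
      by apply: ler_sum => i _; have := g0 i; lra.
    move: aS; rewrite (bigID (fun i => c i <= 2)%N) /=.
    rewrite [RHS](bigID (fun i => c i <= 2)%N) /=.
    move: (\sum_(i | _) _) (\sum_(i | _) _) (\sum_(i | _) _) (\sum_(i | _) _) =>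
      A B C E.
    by move: (\sum_(i | _) _) => F; lra.
  have -> : \sum_(i | (c i <= 2)%N) a i = \sum_(i | (c i <= 2)%N) L i.
    by apply: eq_bigr => i /D.
  by move: S x0; move: (\sum_(i | _) _) (\sum_(i | _) _) => A B; lra.
split.
- by move=> i ei; have := Lf i; rewrite cE ei => /eqP.
- move=> i; have := Lf i; case: ifP => // /negbT;
    rewrite cE negbK => /andP[da _] /eqP->.
  by have := f0 i; lra.
- rewrite (bigID (fun i => c i <= 2)%N) /= [RHS](bigID (fun i => c i <= 2)%N) /=.
  congr (_ + _); first by rewrite -S xE add0r.
  by apply: eq_bigr => i /negPf ci; have := Lf i; rewrite ci => /eqP.
- case: D => [D|[_ [j cj D]]]; [left=> i|right].
    by rewrite -cE; exact: D.
  by exists j; rewrite -?cE // => i; rewrite -cE; exact: D.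
Qed.
End Greedy.

(** * Runs of programs *)

Section Runs.
Variable R : realFieldType.
Implicit Types (st : state R) (Q : state R -> Prop) (c : cmd) (t : nat).

(** A weakest precondition with a time bound. Postconditions nest under sequencing, so programs are
    verified by forward symbolic execution. *)
Definition runs c st Q t : Prop :=
  exists st' t', [/\ exec c st st' t', (t' <= t)%N & Q st'].

Lemma runs_weaken c st Q Q' t t' :
  (forall st', Q st' -> Q' st') -> (t <= t')%N -> runs c st Q t -> runs c st Q' t'.
Proof.
by move=> QQ' tt' [st' [t1 [e lt1 /QQ' q]]]; exists st', t1;
  rewrite (leq_trans lt1).
Qed.

Lemma runs_le c st Q t t' : (t <= t')%N -> runs c st Q t -> runs c st Q t'.
Proof. exact: runs_weaken. Qed.

Lemma runs_skip st Q : Q st -> runs Skip st Q 0.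
Proof. by exists st, 0%N; split=> //; exact: exec_skip. Qed.

Lemma runs_iset st Q a j x :
  Q (State (update (imem st) a (ieval st j) (ieval st x)) (rmem st)) ->
  runs (ISet a j x) st Q 1.
Proof. by move=> q; eexists _, 1%N; split; [exact: exec_iset| |]. Qed.

Lemma runs_rset st Q a j x :
  Q (State (imem st) (update (rmem st) a (ieval st j) (reval st x))) ->
  runs (RSet a j x) st Q 1.
Proof. by move=> q; eexists _, 1%N; split; [exact: exec_rset| |]. Qed.

Lemma runs_seq c1 c2 st Q t1 t2 :
  runs c1 st (fun st' => runs c2 st' Q t2) t1 -> runs (Seq c1 c2) st Q (t1 + t2).
Proof.
case=> st1 [u1 [e1 l1 [st2 [u2 [e2 l2 q]]]]].
by exists st2, (u1 + u2)%N; split; [exact: exec_seq e1 e2|exact: leq_add|].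
Qed.

Lemma runs_if b c1 c2 st Q t :
  runs (if beval st b then c1 else c2) st Q t -> runs (If b c1 c2) st Q t.+1.
Proof.
case: ifP => bE [st' [u [e l q]]]; exists st', u.+1; split=> //.
  exact: exec_if_true.
by apply: exec_if_false e; rewrite bE.
Qed.

Lemma runs_while_stop b c st Q : ~~ beval st b -> Q st -> runs (While b c) st Q 1.
Proof. by exists st, 1%N; split=> //; exact: exec_while_false. Qed.

Lemma runs_while_step b c st Q t1 t2 : beval st b ->
  runs c st (fun st' => runs (While b c) st' Q t2) t1 ->
  runs (While b c) st Q (t1 + t2).+1.
Proof.
move=> bE [st1 [u1 [e1 l1 [st2 [u2 [e2 l2 q]]]]]].
exists st2, (u1 + u2).+1; split=> //; first exact: exec_while_true bE e1 e2.
by rewrite ltnS leq_add.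
Qed.

Definition get0 (a : nat) : iexp := IGet a (ICst 0).

Definition for_up (a : nat) (bound : iexp) c : cmd :=
  Seq (ISet a (ICst 0) (ICst 0))
    (While (BNot (BILe bound (get0 a)))
      (Seq c (ISet a (ICst 0) (IAdd (get0 a) (ICst 1))))).

(** Each round costs two steps beyond the body, for the test and the increment; the final two are
    the initialization and the failing test. *)
Lemma runs_for_up a bound c st (Inv : nat -> state R -> Prop) N t :
  Inv 0%N (State (update (imem st) a 0 0%N) (rmem st)) ->
  (forall k st', (k <= N)%N -> Inv k st' ->
     imem st' a 0%N = k /\ ieval st' bound = N) ->
  (forall k st', (k < N)%N -> Inv k st' ->
     runs c st' (fun st'' =>
       Inv k.+1 (State (update (imem st'') a 0 (imem st'' a 0).+1) (rmem st'')))
         t) ->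
  runs (for_up a bound c) st (Inv N) (N * t.+2).+2.
Proof.
move=> I0 IE Ic.
have loop m k st' : (m + k = N)%N -> Inv k st' ->
    runs (While (BNot (BILe bound (get0 a)))
      (Seq c (ISet a (ICst 0) (IAdd (get0 a) (ICst 1))))) st' (Inv N) (m * t.+2).+1.
  elim: m k st' => [|m IH] k st' mk Ik.
    have kN : (k <= N)%N by lia.
    have [aE bE] := IE k st' kN Ik.
    by rewrite mul0n; apply: runs_while_stop; rewrite /= ?aE ?bE -mk ?leqnn.
  have kN : (k < N)%N by lia.
  have [aE bE] := IE k st' (ltnW kN) Ik.
  rewrite mulSn -[((_ + _).+1)%N]/((t.+2 + m * t.+2).+1)%N.
  rewrite (_ : (t.+2 + m * t.+2 = (t + 1) + (m * t.+2).+1)%N); last by lia.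
  apply: runs_while_step; first by rewrite /= aE bE -ltnNge.
  apply: runs_seq; apply: runs_weaken (Ic k st' kN Ik) => // st'' Ik'.
  apply: runs_iset; apply: (IH k.+1) => //=; first by lia.
  by rewrite addn1.
rewrite -[(_.+2)%N]/((1 + (N * t.+2).+1)%N).
by apply: runs_seq; apply: runs_iset => /=; apply: (loop N 0%N) => //;
  rewrite addn0.
Qed.

Definition iframe (S : seq nat) st st' : Prop :=
  forall b j, b \notin S -> imem st' b j = imem st b j.

Definition ncom : iexp := IGet 0 (ICst 2).
Definition com : iexp := get0 9.

Definition row_set (A : nat) (base : iexp) (x : rexp) : cmd :=
  for_up 9 ncom (RSet A (IAdd base com) x).

(** The hypothesis on [x] concerns states in which only earlier cells of the row have changed, so
    [x] may read the very cell it overwrites. *)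
Lemma runs_row_set A base x st n b f :
  imem st 0%N 2%N = n ->
  (forall st', iframe [:: 9%N] st st' ->
     (forall B j, ~~ ((B == A) && (b <= j < b + imem st' 9%N 0%N)%N) ->
        rmem st' B j = rmem st B j) ->
     (imem st' 9%N 0%N < n)%N ->
     ieval st' base = b /\ reval st' x = f (imem st' 9%N 0%N)) ->
  runs (row_set A base x) st
    (fun st' => iframe [:: 9%N] st st' /\
       forall B j, rmem st' B j =
         if (B == A) && (b <= j < b + n)%N then f (j - b)%N else rmem st B j)
    (n * 3).+2.
Proof.
move=> nE xE.
pose Inv k st' := [/\ imem st' 9%N 0%N = k, iframe [:: 9%N] st st'
  & forall B j, rmem st' B j =
      if (B == A) && (b <= j < b + k)%N then f (j - b)%N else rmem st B j].
apply: (@runs_weaken _ _ (Inv n) _ (n * 3).+2) => //; first by move=> st' [].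
apply: runs_for_up.
- split=> // [B j nB|B j] /=; last by rewrite addn0 ltnNge andbN andbF.
  by move: nB; rewrite inE /= /update => /negPf->.
- by move=> k st' _ [-> fr _]; split=> //=; rewrite fr.
- move=> k st' kn [kE fr rE]; apply: runs_rset.
  have [] := xE st' fr; rewrite ?kE //.
    by move=> B j nj; rewrite rE (negPf nj).
  move=> baseE xE'; rewrite /= kE baseE xE'; split=> //= [B j nB|B j].
    by rewrite -(fr B j nB); move: nB; rewrite inE /= /update => /negPf->.
  rewrite /update rE; have [->|] //= := eqVneq B A.
  have [->|jk] := eqVneq j (b + k)%N; first by rewrite leq_addr addnS ltnSn addKn.
  by congr (if _ then _ else _); lia.
Qed.

Lemma runs_row_set_ord A base x st n b (f : 'I_n -> R) :
  imem st 0%N 2%N = n ->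
  (forall st' (i : 'I_n), iframe [:: 9%N] st st' ->
     (forall B j, ~~ ((B == A) && (b <= j < b + i)%N) -> rmem st' B j = rmem st B
       j) ->
     imem st' 9%N 0%N = i ->
     ieval st' base = b /\ reval st' x = f i) ->
  runs (row_set A base x) st
    (fun st' => [/\ iframe [:: 9%N] st st',
       forall B j, ~~ ((B == A) && (b <= j < b + n)%N) -> rmem st' B j = rmem st B j
     & forall i : 'I_n, rmem st' A (b + i)%N = f i])
    (n * 3).+2.
Proof.
move=> nE xE; pose g j := if insub j is Some i then f i else 0.
apply: (runs_weaken _ (leqnn _) (@runs_row_set A base x st n b g nE _)).
  move=> st' [fr rE]; split=> // [B j nj|i]; first by rewrite rE (negPf nj).
  by rewrite rE eqxx leq_addr ltn_add2l ltn_ord /= addKn /g valK.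
move=> st' fr rE lt9; have [baseE xE'] := xE st' (Ordinal lt9) fr rE erefl.
by split; rewrite // xE' /g (insubT (fun j => (j < n)%N) lt9).
Qed.
End Runs.

(** * The program *)

Definition tree_size m (w : sptree 'I_m) : nat := size (tree_code w).

Lemma tree_size_series m (l r : sptree 'I_m) :
  tree_size (SNode l r) = (tree_size l + tree_size r).+1.
Proof. by rewrite /tree_size /= size_cat. Qed.

Lemma tree_size_parallel m (l r : sptree 'I_m) :
  tree_size (PNode l r) = (tree_size l + tree_size r).+1.
Proof. by rewrite /tree_size /= size_cat. Qed.

(** A full binary tree with m leaves has 2m - 1 nodes, and the leaves are the arcs. The program thus
    finds the end of the code from the number of arcs. *)
Lemma tree_size_arcs G (w : sptree 'I_(na G)) : sp_decomposition w ->
  (tree_size w).+1 = (#|arcs (subdig w)| + #|arcs (subdig w)|)%N.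
Proof.
elim: w => [e|l IHl r IHr|l IHl r IHr] /=; first by rewrite cards1.
  case=> /IHl El /IHr Er [dis _ _]; rewrite tree_size_series cardsU.
  by rewrite disjoint_setI0 // cards0 subn0; lia.
case=> /IHl El /IHr Er [dis _ _ _]; rewrite tree_size_parallel cardsU.
by rewrite disjoint_setI0 // cards0 subn0; lia.
Qed.

(** The preorder code read in place. The right child can be located only through the size of the
    left one, which is why the program computes sizes. *)
Fixpoint coded m (w : sptree 'I_m) (k : nat) (s : nat -> nat) : Prop :=
  match w with
  | QNode e => s k = (e : nat).+2
  | SNode l r => [/\ s k = 0%N, coded l k.+1 s & coded r (k.+1 + tree_size l) s]
  | PNode l r => [/\ s k = 1%N, coded l k.+1 s & coded r (k.+1 + tree_size l) s]
  end.

Lemma coded_nth m (w : sptree 'I_m) k (s : nat -> nat) :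
  (forall j, (j < tree_size w)%N -> s (k + j)%N = nth 0%N (tree_code w) j) ->
    coded w k s.
Proof.
elim: w k => [e|l IHl r IHr|l IHl r IHr] k sE /=; first by rewrite -[k]addn0 sE.
  rewrite tree_size_series in sE; split; first by rewrite -[k]addn0 sE.
    by apply: IHl => j jl; rewrite addSnnS sE ?ltnS; [rewrite /= nth_cat jl|lia].
  apply: IHr => j jr; rewrite -addnA addSnnS sE /=; last by lia.
  by rewrite nth_cat -/(tree_size l) ltnNge leq_addr /= addKn.
rewrite tree_size_parallel in sE; split; first by rewrite -[k]addn0 sE.
  by apply: IHl => j jl; rewrite addSnnS sE ?ltnS; [rewrite /= nth_cat jl|lia].
apply: IHr => j jr; rewrite -addnA addSnnS sE /=; last by lia.
by rewrite nth_cat -/(tree_size l) ltnNge leq_addr /= addKn.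
Qed.

Lemma coded_ext m (w : sptree 'I_m) k (s s' : nat -> nat) :
  s =1 s' -> coded w k s -> coded w k s'.
Proof.
move=> ss; elim: w k => [e|l IHl r IHr|l IHl r IHr] k /=; first by rewrite ss.
  by case=> E /IHl cl /IHr cr; rewrite -ss.
by case=> E /IHl cl /IHr cr; rewrite -ss.
Qed.

(* Integer arrays: 6 holds the row offsets [p * nk], 7 the sizes of the subtrees
   (indexed by preorder position), 8 the current position, 9 the current
   commodity, 10 the commodity classes, 11 the class of the next fractional
   commodity. Field arrays: 3 holds one row of flow values per position, 4 the
   remaining capacity. *)
Definition narcs : iexp := IGet 0 (ICst 1).
Definition pos : iexp := get0 8.
Definition symbol : iexp := IGet 5 pos.
Definition lpos : iexp := IAdd pos (ICst 1).
Definition rpos : iexp := IAdd lpos (IGet 7 lpos).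
Definition cell (p : iexp) : iexp := IAdd (IGet 6 p) com.
Definition share (p : iexp) : rexp := RGet 3 (cell p).

Definition set_offsets : cmd :=
  for_up 8 (IAdd narcs narcs) (ISet 6 lpos (IAdd (IGet 6 pos) ncom)).

Definition collect_node : cmd :=
  If (BILe (ICst 2) symbol)
    (Seq (ISet 7 pos (ICst 1))
      (row_set 3 (IGet 6 pos) (RGet 1 (cell (ISub symbol (ICst 2))))))
    (Seq (ISet 7 pos (IAdd (ICst 1) (IAdd (IGet 7 lpos) (IGet 7 rpos))))
      (If (BILe (ICst 1) symbol)
        (row_set 3 (IGet 6 pos) (RAdd (share lpos) (share rpos)))
        (row_set 3 (IGet 6 pos) (share lpos)))).

(** Scanning backwards, both children of a position already have their sizes and flow rows. *)
Definition collect : cmd :=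
  While (BILe (ICst 1) pos)
    (Seq (ISet 8 (ICst 0) (ISub pos (ICst 1))) collect_node).

(** * The backward pass: sizes and flows of all subtrees *)

Section Collect.
Variables (R : realFieldType) (G : digraph) (I : multiflow_instance R G).
Variable X : 'M[R]_(na G, nk I).
Local Notation n := (nk I).
Implicit Types (st : state R) (w l r : sptree 'I_(na G)) (i : 'I_(nk I)).

Definition env st : Prop :=
  [/\ imem st 0%N 1%N = na G, imem st 0%N 2%N = n,
      forall p, (p <= na G + na G)%N -> imem st 6%N p = (p * n)%N,
      forall i, rmem st 0%N i = dem i
    & forall (e : 'I_(na G)) i, rmem st 1%N (e * n + i)%N = X e i].

Lemma env_frame st st' :
  (forall B j, (B <= 6)%N -> imem st' B j = imem st B j) ->
  (forall B j, (B <= 1)%N -> rmem st' B j = rmem st B j) ->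
  env st -> env st'.
Proof.
move=> fi fr [e1 e2 e3 e4 e5]; split; rewrite ?fi //.
- by move=> p; rewrite fi //; exact: e3.
- by move=> i; rewrite fr.
- by move=> e i; rewrite fr.
Qed.

Definition node_row st (p : nat) i : R := rmem st 3%N (p * n + i)%N.

Fixpoint stored w (k : nat) st : Prop :=
  [/\ imem st 7%N k = tree_size w, forall i, node_row st k i = flow X w i
    & match w with
      | QNode _ => True
      | SNode l r | PNode l r => stored l k.+1 st /\ stored r (k.+1 + tree_size
        l)%N st
      end].

Definition stored_below w (k : nat) st : Prop :=
  match w with
  | QNode _ => True
  | SNode l r | PNode l r => stored l k.+1 st /\ stored r (k.+1 + tree_size l)%N st
  end.

Lemma storedE w k st : stored w k st <->
  [/\ imem st 7%N k = tree_size w, forall i, node_row st k i = flow X w i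
    & stored_below w k st].
Proof. by case: w. Qed.

Lemma tree_size_gt0 w : (0 < tree_size w)%N.
Proof. by case: w. Qed.

Lemma stored_frame w k st st' :
  (forall j, (k <= j < k + tree_size w)%N -> imem st' 7%N j = imem st 7%N j) ->
  (forall j i, (k <= j < k + tree_size w)%N -> node_row st' j i = node_row st j
    i) ->
  stored w k st -> stored w k st'.
Proof.
elim: w k => [e|l IHl r IHr|l IHl r IHr] k fi fr /=.
- have k0 : (k <= k < k + tree_size (QNode e))%N by rewrite leqnn /tree_size /=
    addn1 ltnSn.
  by rewrite fi // => -[-> E _]; split=> // i; rewrite fr.
- rewrite tree_size_series in fi fr;
    have k0 : (k <= k < k + (tree_size l + tree_size r).+1)%N by lia.
  rewrite fi // => -[-> E [sl sr]]; split=> // [i|]; first by rewrite fr.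
  split; [apply: IHl sl|apply: IHr sr] => j *;
    [apply: fi|apply: fr|apply: fi|apply: fr]; lia.
- rewrite tree_size_parallel in fi fr;
    have k0 : (k <= k < k + (tree_size l + tree_size r).+1)%N by lia.
  rewrite fi // => -[-> E [sl sr]]; split=> // [i|]; first by rewrite fr.
  split; [apply: IHl sl|apply: IHr sr] => j *;
    [apply: fi|apply: fr|apply: fi|apply: fr]; lia.
Qed.

Lemma stored_below_frame w k st st' :
  (forall j, (k < j < k + tree_size w)%N -> imem st' 7%N j = imem st 7%N j) ->
  (forall j i, (k < j < k + tree_size w)%N -> node_row st' j i = node_row st j i) ->
  stored_below w k st -> stored_below w k st'.
Proof.
case: w => [e|l r|l r] //;
  rewrite ?tree_size_series ?tree_size_parallel => fi fr [sl sr].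
  split; [apply: stored_frame sl|apply: stored_frame sr] => j *;
    [apply: fi|apply: fr|apply: fi|apply: fr]; lia.
split; [apply: stored_frame sl|apply: stored_frame sr] => j *;
  [apply: fi|apply: fr|apply: fi|apply: fr]; lia.
Qed.

Definition collect_frame (k m : nat) st st' : Prop :=
  (forall B j, B \notin [:: 8; 9]%N -> ~~ ((B == 7) && (k <= j < k + m))%N ->
     imem st' B j = imem st B j) /\
  (forall B j, ~~ ((B == 3) && (k * n <= j < (k + m) * n))%N ->
     rmem st' B j = rmem st B j).

Lemma collect_node_runs w k st :
  sp_decomposition w -> env st -> coded w k (imem st 5%N) ->
  imem st 8%N 0%N = k -> (k + tree_size w <= na G + na G)%N -> stored_below w k
    st ->
  runs collect_node st (fun st' =>
    [/\ collect_frame k 1 st st', imem st' 8%N 0%N = k & stored w k st'])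
    (n * 3 + 5)%N.
Proof.
move=> sp [e1 e2 e3 e4 e5] cw kE kle sb.
have kn p : (p < k + tree_size w)%N -> imem st 6%N p = (p * n)%N.
  by move=> ?; apply: e3; lia.
(* Every kind of node ends by writing its own row; only the expression for the entries differs. *)
have finish A base x st1 :
    iframe [:: 7%N] st st1 -> rmem st1 = rmem st ->
    (forall j, j != k -> imem st1 7%N j = imem st 7%N j) ->
    imem st1 7%N k = tree_size w -> A = 3%N ->
    (forall st' i, iframe [:: 9%N] st1 st' ->
       (forall B j, ~~ ((B == 3) && (k * n <= j < k * n + i))%N ->
          rmem st' B j = rmem st B j) ->
       imem st' 9%N 0%N = i ->
       ieval st' base = (k * n)%N /\ reval st' x = flow X w i) ->
    runs (row_set A base x) st1 (fun st' =>
      [/\ collect_frame k 1 st st', imem st' 8%N 0%N = k & stored w k st'])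
      (n * 3).+2.
  move=> f7 rE f7k sz -> xE.
  have n1E : imem st1 0%N 2%N = n by rewrite f7.
  rewrite -rE in xE.
  apply: runs_weaken (leqnn _) (runs_row_set_ord n1E xE) => st' [fi fr fw].
  have fi7 j : imem st' 7%N j = imem st1 7%N j by rewrite fi.
  split; first split.
  - move=> B j; rewrite !inE negb_or => /andP[B8 B9] nB.
    rewrite fi ?inE ?B9 //; have [B7|B7] := eqVneq B 7%N; last by rewrite f7 ?inE.
    rewrite B7 f7k //; apply: contraNneq nB => ->.
    by rewrite B7 eqxx addn1 !leqnn.
  - move=> B j nB; rewrite fr ?rE //; apply: contraNN nB.
    by rewrite addn1 mulSn addnC.
  - by rewrite fi // f7.
  - apply/storedE; split=> //; first by rewrite fi7.
    apply: stored_below_frame sb => [j|j i] /andP[kj jw].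
      by rewrite fi7 f7k // neq_ltn kj orbT.
    have ge : (k * n + n <= j * n + i)%N.
      by rewrite (leq_trans _ (leq_addr _ _)) // addnC -mulSn leq_mul2r kj orbT.
    by rewrite /node_row fr ?rE // [(_ < k * n + n)%N]ltnNge ge !andbF.
have upd m : iframe [:: 7%N] st (State (update (imem st) 7 k m) (rmem st)).
  by move=> B j; rewrite inE /= /update => /negPf->.
have upd7 m j : j != k -> update (imem st) 7 k m 7%N j = imem st 7%N j.
  by rewrite /update eqxx => /negPf->.
have updN m B j : B != 7%N -> update (imem st) 7 k m B j = imem st B j.
  by rewrite /update => /negPf->.
have updk m : update (imem st) 7 k m 7%N k = m by rewrite /update !eqxx.
case: w sp cw kle sb kn finish => [e|l r|l r] sp cw kle sb kn finish.
- apply: (@runs_le _ _ _ _ (1 + (n * 3).+2).+1); first by lia.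
  apply: runs_if; rewrite /= kE cw /=; apply: runs_seq; apply: runs_iset.
  rewrite /= kE; apply: finish => //=.
    by move=> j jk; rewrite upd7.
  move=> st' i fi fr iE; have f5 B j : B \notin [:: 9;
    7]%N -> imem st' B j = imem st B j.
    by rewrite inE negb_or => /andP[B9 B7]; rewrite fi ?upd // inE.
  rewrite /= iE !f5 // kE cw subn2 /= kn;
    last by rewrite -[X in (X < _)%N]addn0 ltn_add2l.
  by rewrite fr // e3 ?e5 ?flow_leaf //; have := ltn_ord e; lia.
- case: cw => c0 _ _; apply: (@runs_le _ _ _ _ (1 + (n * 3).+2.+1).+1);
    first by lia.
  have [/storedE[zl rl _] /storedE[zr rr _]] := sb;
    rewrite tree_size_series in kn kle finish.
  have l0 := tree_size_gt0 l; have r0 := tree_size_gt0 r.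
  apply: runs_if; rewrite /= kE c0 /=; apply: runs_seq; apply: runs_iset.
  rewrite /= kE addn1 zl zr add1n.
  apply: runs_if; rewrite /= !updN // kE c0 /=; apply: finish => //=.
    by move=> j jk; rewrite upd7.
  move=> st' i fi fr iE; have f5 B j : B \notin [:: 9;
    7]%N -> imem st' B j = imem st B j.
    by rewrite inE negb_or => /andP[B9 B7]; rewrite fi ?upd // inE.
  have frow p : (k < p)%N -> rmem st' 3%N (p * n + i)%N = node_row st p i.
    move=> kp; have ge : (k * n + i <= p * n + i)%N.
      by rewrite leq_add2r leq_mul2r (ltnW kp) orbT.
    by rewrite fr // [(_ < k * n + i)%N]ltnNge ge !andbF.
  rewrite /= iE !f5 // kE addn1 !kn; [|lia..]; split=> //.
  by rewrite frow // rl flow_series.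
- case: cw => c0 _ _; apply: (@runs_le _ _ _ _ (1 + (n * 3).+2.+1).+1);
    first by lia.
  have [/storedE[zl rl _] /storedE[zr rr _]] := sb;
    rewrite tree_size_parallel in kn kle finish.
  have l0 := tree_size_gt0 l; have r0 := tree_size_gt0 r.
  apply: runs_if; rewrite /= kE c0 /=; apply: runs_seq; apply: runs_iset.
  rewrite /= kE addn1 zl zr add1n.
  apply: runs_if; rewrite /= !updN // kE c0 /=; apply: finish => //=.
    by move=> j jk; rewrite upd7.
  move=> st' i fi fr iE; have f5 B j : B \notin [:: 9;
    7]%N -> imem st' B j = imem st B j.
    by rewrite inE negb_or => /andP[B9 B7]; rewrite fi ?upd // inE.
  have frow p : (k < p)%N -> rmem st' 3%N (p * n + i)%N = node_row st p i.
    move=> kp; have ge : (k * n + i <= p * n + i)%N.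
      by rewrite leq_add2r leq_mul2r (ltnW kp) orbT.
    by rewrite fr // [(_ < k * n + i)%N]ltnNge ge !andbF.
  have z7 : imem st' 7%N k.+1 = tree_size l by rewrite fi //= upd7 // neq_ltn
    ltnSn orbT.
  have k8 : imem st' 8%N 0%N = k by rewrite f5.
  rewrite /= iE k8 addn1 z7 !f5 // !kn; [|lia..]; split=> //.
  by rewrite !frow ?rl ?rr ?flow_parallel //; lia.
Qed.

Lemma collect_frame_weaken k m k' m' st st' :
  (k' <= k)%N -> (k + m <= k' + m')%N ->
  collect_frame k m st st' -> collect_frame k' m' st st'.
Proof.
move=> kk km [fi fr]; split=> B j.
  by move=> nB nj; apply: fi => //; apply: contraNN nj => /andP[-> ?]; lia.
move=> nj; apply: fr; apply: contraNN nj => /and3P[-> kj jk].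
by rewrite (leq_trans _ kj) ?leq_mul2r ?kk ?orbT // (leq_trans jk) // leq_mul2r
  km orbT.
Qed.

Lemma collect_frame_trans k m st1 st2 st3 :
  collect_frame k m st1 st2 -> collect_frame k m st2 st3 -> collect_frame k m st1
    st3.
Proof.
move=> [i12 r12] [i23 r23]; split=> B j *; first by rewrite i23 // i12.
by rewrite r23 // r12.
Qed.

Lemma collect_frame_env k m st st' : collect_frame k m st st' -> env st -> env st'.
Proof.
move=> [fi fr]; apply: env_frame => B j leB.
  by apply: fi; [rewrite !inE; lia|apply: contraL leB => /andP[/eqP->]].
by apply: fr; apply: contraL leB => /andP[/eqP->].
Qed.

Lemma collect_frame_code k m st st' w j : collect_frame k m st st' ->
  coded w j (imem st 5%N) -> coded w j (imem st' 5%N).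
Proof. by case=> fi _; apply: coded_ext => p; rewrite fi. Qed.

Lemma collect_frame_stored k m st st' w p : collect_frame k m st st' ->
  (p + tree_size w <= k)%N || (k + m <= p)%N -> stored w p st -> stored w p st'.
Proof.
move=> [fi fr] dis; apply: stored_frame => [j|j i] pj.
  by apply: fi => //=; lia.
apply: fr => /=; rewrite negb_and -leqNgt -ltnNge; apply/orP.
have ni := ltn_ord i; case/orP: dis => dis; [left|right].
  apply: (@leq_trans (j.+1 * n)%N); first by rewrite mulSn addnC ltn_add2r.
  by rewrite leq_mul2r; apply/orP; right; lia.
by rewrite (leq_trans _ (leq_addr _ _)) // leq_mul2r; apply/orP; right; lia.
Qed.

Lemma collect_step w k st Q t :
  sp_decomposition w -> env st -> coded w k (imem st 5%N) ->
  imem st 8%N 0%N = k.+1 -> (k + tree_size w <= na G + na G)%N -> stored_below w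
    k st ->
  (forall st', collect_frame k 1 st st' -> imem st' 8%N 0%N = k -> stored w k st' ->
     runs collect st' Q t) ->
  runs collect st Q (t + (n * 3 + 7))%N.
Proof.
move=> sp ev cw kE kle sb next.
apply: (@runs_le _ _ _ _ ((1 + (n * 3 + 5)) + t).+1); first by lia.
apply: runs_while_step; first by rewrite /= kE.
apply: runs_seq; apply: runs_iset; rewrite /= kE subn1 /=.
set st1 := State _ _.
have f1 : collect_frame k 1 st st1.
  by split=> // B j; rewrite !inE negb_or /= /update => /andP[/negPf->].
have ev1 := collect_frame_env f1 ev; have cw1 := collect_frame_code f1 cw.
have sb1 : stored_below w k st1 by apply: stored_below_frame sb.
have k1 : imem st1 8%N 0%N = k by [].
apply: runs_weaken (leqnn _) (collect_node_runs sp ev1 cw1 k1 kle sb1).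
by move=> st' [f2 k2 s2]; apply: next => //; exact: collect_frame_trans f1 f2.
Qed.

(** The continuation [Q] stands for the rest of one flat loop: the induction on the tree consumes
    [tree_size w] of its rounds. *)
Lemma collect_runs w k st Q t :
  sp_decomposition w -> env st -> coded w k (imem st 5%N) ->
  imem st 8%N 0%N = (k + tree_size w)%N -> (k + tree_size w <= na G + na G)%N ->
  (forall st', collect_frame k (tree_size w) st st' -> imem st' 8%N 0%N = k ->
     stored w k st' -> runs collect st' Q t) ->
  runs collect st Q (t + tree_size w * (n * 3 + 7))%N.
Proof.
have children l r k' st' Q' t' :
    (forall k st Q t, env st -> coded l k (imem st 5%N) ->
      imem st 8%N 0%N = (k + tree_size l)%N -> (k + tree_size l <= na G + na G)%N ->
      (forall st', collect_frame k (tree_size l) st st' -> imem st' 8%N 0%N = k ->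
        stored l k st' -> runs collect st' Q t) ->
      runs collect st Q (t + tree_size l * (n * 3 + 7))%N) ->
    (forall k st Q t, env st -> coded r k (imem st 5%N) ->
      imem st 8%N 0%N = (k + tree_size r)%N -> (k + tree_size r <= na G + na G)%N ->
      (forall st', collect_frame k (tree_size r) st st' -> imem st' 8%N 0%N = k ->
        stored r k st' -> runs collect st' Q t) ->
      runs collect st Q (t + tree_size r * (n * 3 + 7))%N) ->
    env st' -> coded l k'.+1 (imem st' 5%N) ->
    coded r (k'.+1 + tree_size l) (imem st' 5%N) ->
    imem st' 8%N 0%N = (k' + (tree_size l + tree_size r).+1)%N ->
    (k' + (tree_size l + tree_size r).+1 <= na G + na G)%N ->
    (forall st'', collect_frame k' (tree_size l + tree_size r).+1 st' st'' ->
      imem st'' 8%N 0%N = k'.+1 -> stored l k'.+1 st'' ->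
      stored r (k'.+1 + tree_size l) st'' ->
      runs collect st'' Q' (t' + (n * 3 + 7))%N) ->
    runs collect st' Q' (t' + (tree_size l + tree_size r).+1 * (n * 3 + 7))%N.
  move=> IHl IHr ev cl cr kE kle next.
  apply: (@runs_le _ _ _ _ (t' + (n * 3 + 7) + tree_size l * (n * 3 + 7)
    + tree_size r * (n * 3 + 7))%N); first by rewrite mulSn mulnDl; lia.
  (* Going backwards, the right subtree comes first. *)
  apply: (IHr (k'.+1 + tree_size l)%N) => //; [by lia..|move=> st1 f1 k1 s1].
  apply: (IHl k'.+1) => //; [exact: collect_frame_env f1 ev
    |exact: collect_frame_code f1 cl|by lia|move=> st2 f2 k2 s2].
  apply: next => //.
    apply: (@collect_frame_trans _ _ _ st1).
      by apply: collect_frame_weaken f1; lia.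
    by apply: collect_frame_weaken f2; lia.
  by apply: collect_frame_stored f2 _ s1; lia.
elim: w k st Q t => [e|l IHl r IHr|l IHl r IHr] k st Q t sp ev cw kE kle next.
- rewrite mul1n; apply: (@collect_step (QNode e) k) => //.
  by rewrite kE addn1.
- have [spl spr _] := sp; have [c0 cl cr] := cw;
    rewrite tree_size_series in kE kle next *.
  apply: (children l r k _ _ _ (fun k st Q t => IHl k st Q t spl)
    (fun k st Q t => IHr k st Q t spr)) => //.
  move=> st1 f1 k1 sl sr; apply: (@collect_step (SNode l r) k) => //.
  + exact: collect_frame_env f1 ev.
  + exact: collect_frame_code f1 cw.
  + by rewrite tree_size_series.
  + move=> st2 f2 k2 s2; apply: next => //; apply: collect_frame_trans f1 _.
    by apply: collect_frame_weaken f2; lia.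
- have [spl spr _] := sp; have [c0 cl cr] := cw;
    rewrite tree_size_parallel in kE kle next *.
  apply: (children l r k _ _ _ (fun k st Q t => IHl k st Q t spl)
    (fun k st Q t => IHr k st Q t spr)) => //.
  move=> st1 f1 k1 sl sr; apply: (@collect_step (PNode l r) k) => //.
  + exact: collect_frame_env f1 ev.
  + exact: collect_frame_code f1 cw.
  + by rewrite tree_size_parallel.
  + move=> st2 f2 k2 s2; apply: next => //; apply: collect_frame_trans f1 _.
    by apply: collect_frame_weaken f2; lia.
Qed.
End Collect.

(** * Commands of the forward pass *)

Definition capacity : rexp := RGet 4 (ICst 0).
Definition demand : rexp := RGet 0 com.

Definition excluded_test : bexp :=
  BAnd (BRLe demand (share pos))
    (BNot (BAnd (BNot (BRLe demand (share lpos)))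
                (BNot (BRLe demand (share rpos))))).

(** There are no field constants, so zero is written as a difference of equal terms. *)
Definition fractional_test : bexp :=
  BAnd (BNot (BRLe (share pos) (RSub demand demand)))
       (BNot (BRLe demand (share pos))).

Definition classify : cmd :=
  for_up 9 ncom
    (If excluded_test (ISet 10 com (ICst 3))
      (Seq (RSet 4 (ICst 0) (RAdd capacity (share lpos)))
        (If fractional_test
          (Seq (ISet 10 com (get0 11)) (ISet 11 (ICst 0) (ICst 2)))
          (ISet 10 com (ICst 1))))).

(** One sweep per class replaces sorting. Class 3 is never swept, so excluded commodities keep their
    flows of [X] in both child rows. *)
Definition fill_class (q : nat) : cmd :=
  for_up 9 ncom
    (If (BAnd (BILe (IGet 10 com) (ICst q)) (BILe (ICst q) (IGet 10 com)))
      (Seq (If (BRLe (share pos) capacity) (RSet 3 (cell lpos) (share pos))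
             (RSet 3 (cell lpos) capacity))
        (Seq (RSet 4 (ICst 0) (RSub capacity (share lpos)))
             (RSet 3 (cell rpos) (RSub (share pos) (share lpos)))))
      Skip).

Definition split_node : cmd :=
  Seq (ISet 11 (ICst 0) (ICst 0))
    (Seq (RSet 4 (ICst 0) (RSub capacity capacity))
      (Seq classify
        (Seq (fill_class 0) (Seq (fill_class 1) (fill_class 2))))).

(** At an s-node the right row is written first, because its formula needs the left row while that
    still holds the flow of [X]. *)
Definition distribute_node : cmd :=
  If (BILe (ICst 2) symbol)
    (row_set 2 (IGet 6 (ISub symbol (ICst 2))) (share pos))
    (If (BILe (ICst 1) symbol) split_node
      (Seq (row_set 3 (IGet 6 rpos)
              (RSub (RAdd (share rpos) (share pos)) (share lpos)))
           (row_set 3 (IGet 6 lpos) (share pos)))).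

(** The position just past the last node: the backward pass starts here and the forward pass stops
    here. *)
Definition last_pos : iexp := ISub (IAdd narcs narcs) (ICst 1).

Definition distribute : cmd :=
  While (BNot (BILe last_pos pos))
    (Seq distribute_node (ISet 8 (ICst 0) (IAdd pos (ICst 1)))).

(** * Correctness of the split at a p-node *)

Section Distribute.
Variables (R : realFieldType) (G : digraph) (I : multiflow_instance R G).
Variable X : 'M[R]_(na G, nk I).
Local Notation n := (nk I).
Local Notation dem := (@dem R G I).
Implicit Types (st : state R) (w l r : sptree 'I_(na G)) (i : 'I_(nk I)).

Lemma cell_inj (p p' : nat) i i' :
  (p * n + i == p' * n + i')%N = (p == p') && (i == i').
Proof.
apply/eqP/andP => [E|[/eqP-> /eqP->]] //;
  have n0 : (0 < n)%N := leq_ltn_trans (leq0n i) (ltn_ord i).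
have pE : p = p' by have := congr1 (divn^~ n) E;
  rewrite !divnMDl // !divn_small // !addn0.
by split; apply/eqP => //; apply/val_inj/eqP; move: E; rewrite pE => /eqP;
  rewrite eqn_add2l.
Qed.

Definition node_ctx (k s : nat) st : Prop :=
  [/\ env X st, imem st 8%N 0%N = k, imem st 7%N k.+1 = s,
      (k.+1 + s <= na G + na G)%N & (0 < s)%N].

Lemma node_ctx_frame k s st st' :
  iframe [:: 9; 10; 11]%N st st' ->
  (forall B j, B \notin [:: 3; 4]%N -> rmem st' B j = rmem st B j) ->
  node_ctx k s st -> node_ctx k s st'.
Proof.
move=> fi fr [ev k8 s7 ks s0]; split; rewrite ?fi //.
apply: env_frame ev => B j leB; first by apply: fi; rewrite !inE; lia.
by apply: fr; rewrite !inE; lia.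
Qed.

Lemma node_cells k s st i : node_ctx k s st -> imem st 9%N 0%N = i ->
  [/\ ieval st (cell pos) = (k * n + i)%N,
      ieval st (cell lpos) = (k.+1 * n + i)%N,
      ieval st (cell rpos) = ((k.+1 + s) * n + i)%N
    & reval st demand = dem i].
Proof.
case=> -[e1 e2 e3 e4 e5] k8 s7 ks s0 iE.
rewrite /cell /demand /lpos /rpos /pos /get0 /= iE k8 addn1 s7 !e3; [|lia..].
by split.
Qed.

Section SplitNode.
Variables (k s : nat) (st0 : state R).
Hypothesis ctx0 : node_ctx k s st0.
Local Notation a := (node_row st0 k).
Local Notation f := (node_row st0 k.+1).
Local Notation g := (node_row st0 (k.+1 + s)).

Lemma excluded_testE st i : node_ctx k s st -> imem st 9%N 0%N = i ->
  (forall p, node_row st p i = node_row st0 p i) ->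
  beval st excluded_test = excluded f g a dem i.
Proof.
move=> ctx iE rE; have [pE lE rE' dE] := node_cells ctx iE.
rewrite /excluded -!rE /node_row -pE -lE -rE' -dE.
by rewrite /excluded_test /= negb_and !negbK.
Qed.

Lemma fractional_testE st i : node_ctx k s st -> imem st 9%N 0%N = i ->
  (forall p, node_row st p i = node_row st0 p i) ->
  beval st fractional_test = (0 < a i < dem i).
Proof.
move=> ctx iE rE; have [pE lE rE' dE] := node_cells ctx iE.
rewrite -!rE /node_row -pE -dE /fractional_test.
by rewrite [beval _ _]/= subrr -!ltNge.
Qed.

Lemma classify_runs :
  rmem st0 4%N 0%N = 0 -> imem st0 11%N 0%N = 0%N ->
  runs classify st0 (fun st =>
    [/\ iframe [:: 9; 10; 11]%N st0 st,
        forall B j, B != 4%N -> rmem st B j = rmem st0 B j,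
        classifies f g a dem (fun i => imem st 10%N i)
      & rmem st 4%N 0%N = \sum_(i | (imem st 10%N (i : 'I_n) <= 2)%N) f i])
    (n * 7).+2.
Proof.
move=> x0 nx0; have [[_ nE _ _ _] k8 s7 ks s0] := ctx0.
pose Inv j st := [/\ imem st 9%N 0%N = j, iframe [:: 9; 10; 11]%N st0 st,
  forall B j, B != 4%N -> rmem st B j = rmem st0 B j
  & classify_inv f g a dem j (fun i => imem st 10%N i)
      (imem st 11%N 0%N) (rmem st 4%N 0%N)].
apply: (@runs_weaken _ _ _ (Inv n) _ (n * 7).+2) => //.
  by move=> st [_ fi fr /classify_inv_end[cP xE]].
apply: runs_for_up.
- split=> //=.
    by move=> B j; rewrite !inE !negb_or /= /update => /and3P[/negPf-> _ _].
  rewrite x0 /update /= nx0; exact: classify_inv0.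
- by move=> j st _ [-> fi _ _]; rewrite /= fi.
move=> j st jn [iE fi fr cI]; pose i := Ordinal jn.
have ctx : node_ctx k s st.
  by apply: node_ctx_frame ctx0 => // B x; rewrite !inE negb_or => /andP[_ /fr].
have rE p : node_row st p i = node_row st0 p i by rewrite /node_row fr.
have [pE lE rE' dE] := node_cells (i := i) ctx iE.
have finish st' c' :
    imem st' 9%N 0%N = j -> iframe [:: 9; 10; 11]%N st st' ->
    (forall B j, B != 4%N -> rmem st' B j = rmem st B j) ->
    (forall p, imem st' 10%N p = if p == j then c' else imem st 10%N p) ->
    c' = (if excluded f g a dem i then 3%N
          else if 0 < a i < dem i then imem st 11%N 0%N else 1%N) ->
    imem st' 11%N 0%N = (if ~~ excluded f g a dem i && (0 < a i < dem i) then 2%N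
                         else imem st 11%N 0%N) ->
    rmem st' 4%N 0%N = (if excluded f g a dem i then rmem st 4%N 0%N
                        else rmem st 4%N 0%N + f i) ->
    Inv j.+1 (State (update (imem st') 9 0 (imem st' 9%N 0%N).+1) (rmem st')).
  move=> jE fi' fr' c10 c'E nE' xE; split=> /=.
  - by rewrite /update /= jE.
  - move=> B x nB; rewrite -(fi _ _ nB) -(fi' _ _ nB); move: nB.
    by rewrite !inE negb_or /= /update => /andP[/negPf->].
  - by move=> B x nB; rewrite fr' // fr.
  - rewrite /update /= xE nE'; apply: (classify_inv_step (i := i) cI) => [x xi|].
      by rewrite c10 -val_eqE /= in xi *; rewrite (negPf xi).
    by rewrite c10 eqxx.
apply: (@runs_le _ _ _ _ 5) => //; apply: runs_if.
rewrite (excluded_testE (i := i) ctx iE rE); case: ifP => ei.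
  apply: (@runs_le _ _ _ _ 1) => //; apply: runs_iset.
  apply: (finish _ 3%N) => //=; rewrite ?ei // /update /=.
  - by move=> B x; rewrite !inE !negb_or /= /update => /and3P[_ /negPf-> _].
  - by move=> p; rewrite iE.
apply: (@runs_le _ _ _ _ (1 + 3)) => //; apply: runs_seq; apply: runs_rset;
  apply: runs_if.
set st1 := State _ _.
have fr1 B x : B != 4%N -> rmem st1 B x = rmem st B x.
  by rewrite /= /update => /negPf->.
have ctx1 : node_ctx k s st1.
  by apply: node_ctx_frame ctx => // B x; rewrite !inE negb_or => /andP[_ /fr1].
have rE1 p : node_row st1 p i = node_row st0 p i by rewrite -rE /node_row fr1.
have x1 : rmem st1 4%N 0%N = rmem st 4%N 0%N + f i.
  by rewrite -rE /node_row -lE /= /update.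
rewrite (fractional_testE (i := i) ctx1 iE rE1); case: ifP => fi'.
  apply: (@runs_le _ _ _ _ (1 + 1)) => //; apply: runs_seq; apply: runs_iset;
    apply: runs_iset.
  apply: (finish _ (imem st 11%N 0%N)) => //=; rewrite ?ei ?fi' //.
  - by move=> B x; rewrite !inE !negb_or /= /update => /and3P[_ /negPf-> /negPf->].
  - by move=> p; rewrite /update /= iE.
apply: (@runs_le _ _ _ _ 1) => //; apply: runs_iset.
apply: (finish _ 1%N) => //=; rewrite ?ei ?fi' //.
- by move=> B x; rewrite !inE !negb_or /= /update => /and3P[_ /negPf-> _].
- by move=> p; rewrite /update /= iE.
Qed.

Variable c : 'I_n -> nat.

(** The child rows are overwritten in place; commodities outside [P] still show [f] and [g]
    there. *)
Definition fill_inv (P : pred 'I_n) st : Prop :=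
  [/\ forall B j, B \notin [:: 3; 4]%N -> rmem st B j = rmem st0 B j,
      forall p i, p != k.+1 -> p != (k.+1 + s)%N -> node_row st p i = node_row
        st0 p i,
      forall i, node_row st (k.+1 + s) i
        = if P i then a i - node_row st k.+1 i else g i
    & greedy_inv f a c P (node_row st k.+1) (rmem st 4%N 0%N)].

Lemma fill_inv_ext P P' st : P =1 P' -> fill_inv P st -> fill_inv P' st.
Proof.
move=> PP [fr rE gE gI]; split=> // [i|]; first by rewrite -PP.
exact: greedy_inv_ext gI.
Qed.

Lemma fill_class_runs q st1 :
  (forall i, 0 <= a i) ->
  iframe [:: 9; 10; 11]%N st0 st1 -> (forall i, imem st1 10%N i = c i) ->
  fill_inv (fun i => c i < q)%N st1 ->
  runs (fill_class q) st1
    (fun st => iframe [:: 9]%N st1 st /\ fill_inv (fun i => c i < q.+1)%N st)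
    (n * 7).+2.
Proof.
move=> a0 fi1 c1 I1; have [[_ nE _ _ _] k8 s7 ks s0] := ctx0.
(* Handled in the middle of a sweep: all earlier classes, and the members of class [q] with index
   below [j]. *)
pose P j i := ((c i < q) || (c i == q) && (i < j))%N.
pose Inv j st := [/\ imem st 9%N 0%N = j, iframe [:: 9]%N st1 st & fill_inv (P j)
  st].
apply: (@runs_weaken _ _ _ (Inv n) _ (n * 7).+2) => //.
  move=> st [_ fi FI]; split=> //; apply: fill_inv_ext FI => i.
  by rewrite /P ltn_ord andbT [RHS]ltnS [RHS]leq_eqVlt orbC.
apply: runs_for_up.
- split=> //; first by move=> B j; rewrite inE /= /update => /negPf->.
  by apply: fill_inv_ext I1 => i; rewrite /P andbF orbF.
- by move=> j st _ [-> fi _]; rewrite /= fi // fi1.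
move=> m st jn [iE fi FI].
have [i im] : exists i : 'I_n, nat_of_ord i = m by exists (Ordinal jn).
rewrite -{m}im in iE FI jn *.
have [fr rE gE gI] := FI.
have ctx : node_ctx k s st.
  apply: node_ctx_frame ctx0 => // B x nB; rewrite fi ?fi1 //.
  by move: nB; rewrite !inE !negb_or => /and3P[].
have [pE lE rE' _] := node_cells (i := i) ctx iE.
have tick st' P' : imem st' = imem st -> P' =1 P i.+1 -> fill_inv P' st' ->
    Inv i.+1 (State (update (imem st') 9 0 (imem st' 9%N 0%N).+1) (rmem st')).
  move=> iE' PP FI'; split.
  - by rewrite /update /= iE' iE.
  - by move=> B x nB; rewrite -(fi _ _ nB); move: nB;
      rewrite inE /= /update iE' => /negPf->.
  - exact: fill_inv_ext PP FI'.
have ciE : imem st 10%N i = c i by rewrite fi // (c1 i).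
apply: (@runs_le _ _ _ _ 5) => //; apply: runs_if.
rewrite [beval _ _]/= iE ciE -eqn_leq; case: (eqVneq (c i) q) => [ci|ci];
  last first.
  apply: (@runs_le _ _ _ _ 0) => //; apply: runs_skip.
  apply: (tick st (P i)) => // x;
    rewrite /P [(x < i.+1)%N]ltnS [(x <= i)%N]leq_eqVlt.
  have [xi|] := eqVneq x i; first by rewrite xi (negPf ci) !andFb.
  by rewrite -val_eqE /= => /negPf->.
set v := if a i <= rmem st 4%N 0%N then a i else rmem st 4%N 0%N.
have l_neq : (k == k.+1) = false by lia.
have lr_neq : (k.+1 + s == k.+1)%N = false by lia.
have rl_neq : (k.+1 == k.+1 + s)%N = false by lia.
have kr_neq : (k == k.+1 + s)%N = false by lia.
have reads st' : imem st' = imem st ->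
    [/\ reval st' (share pos) = node_row st' k i,
        reval st' (share lpos) = node_row st' k.+1 i,
        ieval st' (cell lpos) = (k.+1 * n + i)%N
      & ieval st' (cell rpos) = ((k.+1 + s) * n + i)%N].
  move=> iE'; have ext x : ieval st' x = ieval st x.
    by elim: x => //= [b x ->|x -> y ->|x -> y ->]; rewrite ?iE'.
  by split; rewrite ?ext // /node_row -?pE -?lE -ext.
have [p1 l1 lc1 rc1] := reads st erefl.
have aE : node_row st k i = a i by rewrite rE ?l_neq ?kr_neq.
apply: (@runs_le _ _ _ _ (2 + 2)) => //; apply: runs_seq; apply: runs_if.
set st2 := State (imem st) (update (rmem st) 3 (k.+1 * n + i) v).
have row2 p i' : node_row st2 p i'
    = if (p == k.+1) && (i' == i) then v else node_row st p i'.
  by rewrite /node_row /= /update /= cell_inj.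
(* Both branches store the minimum [v] of amount and capacity, so what follows is verified once. *)
suff done2 : runs (Seq (RSet 4 (ICst 0) (RSub capacity (share lpos)))
    (RSet 3 (cell rpos) (RSub (share pos) (share lpos)))) st2 (fun st'' =>
    Inv i.+1 (State (update (imem st'') 9 0 (imem st'' 9%N 0%N).+1) (rmem st''))) 2.
  rewrite -[beval _ _]/(reval st (share pos) <= rmem st 4%N 0%N) p1 aE.
  move: done2; rewrite /st2 /v; case: ifP => _ d2; apply: runs_rset;
    by rewrite lc1 ?p1 ?aE.
have [p2 l2 _ _] := reads st2 erefl.
apply: (@runs_le _ _ _ _ (1 + 1)) => //; apply: runs_seq; apply: runs_rset.
rewrite -[reval _ _]/(rmem st2 4%N 0%N - reval st2 (share lpos)) l2 row2 !eqxx /=.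
set st3 := State _ _; have [p3 l3 _ rc3] := reads st3 erefl.
have row3 p i' : node_row st3 p i' = node_row st2 p i' by [].
apply: runs_rset; rewrite rc3.
rewrite -[reval _ _]/(reval st3 (share pos) - reval st3 (share lpos)) p3 l3.
rewrite !row3 !row2 !eqxx l_neq /= aE.
pose st4 := State (imem st) (update (rmem st3) 3 ((k.+1 + s) * n + i)%N (a i - v)).
have row4 p i' : node_row st4 p i' = if (p == (k.+1 + s)%N) && (i' == i) then a i
  - v
    else if (p == k.+1) && (i' == i) then v else node_row st p i'.
  by rewrite -row2 -row3 /node_row /= /update /= cell_inj.
have x4 : rmem st4 4%N 0%N = rmem st 4%N 0%N - v by rewrite /= /update /=.
apply: (tick st4 (P i.+1)) => //; split.
- move=> B x; rewrite !inE negb_or => /andP[B3 B4].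
  by rewrite /= /update (negPf B3) (negPf B4) /= fr // !inE negb_or B3.
- by move=> p i' pl pr; rewrite row4 (negPf pl) (negPf pr) /= rE.
- move=> i'; rewrite !row4 !eqxx lr_neq rl_neq /= /P.
  have [->|ii] := eqVneq i' i; first by rewrite ci eqxx ltnSn orbT.
  rewrite gE /P [(i' < i.+1)%N]ltnS [(i' <= i)%N]leq_eqVlt.
  by rewrite -val_eqE /= in ii; rewrite (negPf ii).
- rewrite x4.
  have -> : v = node_row st4 k.+1 i by rewrite row4 rl_neq !eqxx.
  apply: (greedy_inv_step a0 gI (i := i)).
  + by rewrite /P ci ltnn /= eqxx ltnn.
  + by move=> x; rewrite /P ci => /orP[/ltnW|/andP[/eqP-> _]].
  + move=> x; rewrite /P [(x < i.+1)%N]ltnS [(x <= i)%N]leq_eqVlt -val_eqE /=.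
    have [xj|_] := eqVneq (x : nat) i; last by rewrite orbF.
    have -> : x = i by apply/val_inj.
    by rewrite ci eqxx !orbT.
  + by move=> x xi; rewrite row4 (negPf xi) !andbF.
  + by rewrite row4 rl_neq !eqxx.
Qed.
End SplitNode.

(** The time is two assignments and four sweeps of [7 * n + 2] steps each. *)
Lemma split_node_runs k s st :
  node_ctx k s st ->
  let a := node_row st k in
  let f := node_row st k.+1 in
  let g := node_row st (k.+1 + s) in
  (forall i, 0 <= a i <= dem i) -> (forall i, 0 <= f i) -> (forall i, 0 <= g i) ->
  (forall i, f i + g i <= dem i) -> \sum_i a i = \sum_i (f i + g i) ->
  runs split_node st (fun st' =>
    [/\ iframe [:: 9; 10; 11]%N st st',
        forall B j, B \notin [:: 3; 4]%N -> rmem st' B j = rmem st B j,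
        forall p i, p != k.+1 -> p != (k.+1 + s)%N -> node_row st' p i = node_row
          st p i
      & exists c L, [/\ classifies f g a dem c, greedy_split f g a dem c L,
          forall i, node_row st' k.+1 i = L i
        & forall i, node_row st' (k.+1 + s) i = a i - L i]])
    (28 * n + 10)%N.
Proof.
move=> ctx a f g ad f0 g0 fgd aS.
apply: (@runs_le _ _ _ _ (1 + (1 + ((n * 7).+2 + ((n * 7).+2
  + ((n * 7).+2 + (n * 7).+2)))))%N); first by lia.
apply: runs_seq; apply: runs_iset; apply: runs_seq; apply: runs_rset.
apply: runs_seq; set st1 := State _ _.
have fi1 : iframe [:: 9; 10; 11]%N st st1.
  by move=> B j; rewrite !inE !negb_or /= /update => /and3P[_ _ /negPf->].
have fr1 B j : B != 4%N -> rmem st1 B j = rmem st B j.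
  by rewrite /= /update => /negPf->.
have ctx1 : node_ctx k s st1.
  by apply: node_ctx_frame ctx => // B j; rewrite !inE negb_or => /andP[_ /fr1].
have x1 : rmem st1 4%N 0%N = 0 by rewrite /= /update /= subrr.
apply: runs_weaken (leqnn _) (classify_runs ctx1 x1 _) => //.
move=> st2 [fi2 fr2 cP xE]; set c := fun i : 'I_n => imem st2 10%N i.
have a0 i : 0 <= a i by case/andP: (ad i).
have inv0 : fill_inv k s st1 c (fun i => c i < 0)%N st2.
  split=> [B j|p i _ _|i|].
  - by rewrite !inE negb_or => /andP[_ /fr2].
  - by rewrite /node_row fr2.
  - by rewrite ltn0 /node_row fr2.
  - apply: (@greedy_inv_ext _ _ _ _ _ pred0 _ f) => [//|i|].
      by rewrite /node_row fr2.
    exact: greedy_inv0.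
apply: runs_seq;
  apply: runs_weaken (leqnn _) (fill_class_runs ctx1 a0 fi2 _ inv0) => //.
move=> st3 [fi3 inv1].
have fi3' : iframe [:: 9; 10; 11]%N st1 st3.
  by move=> B j nB; rewrite fi3 ?fi2 //; move: nB; rewrite !inE negb_or => /andP[].
have c3 (i : 'I_n) : imem st3 10%N i = c i by rewrite fi3.
apply: runs_seq;
  apply: runs_weaken (leqnn _) (fill_class_runs ctx1 a0 fi3' c3 inv1) => //.
move=> st4 [fi4 inv2].
have fi4' : iframe [:: 9; 10; 11]%N st1 st4.
  by move=> B j nB; rewrite fi4 ?fi3' //; move: nB; rewrite !inE negb_or => /andP[].
have c4 (i : 'I_n) : imem st4 10%N i = c i by rewrite fi4.
apply: runs_weaken (leqnn _) (fill_class_runs ctx1 a0 fi4' c4 inv2) => //.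
move=> st5 [fi5 [fr5 rE5 gE5 gI5]]; split.
- move=> B j nB; rewrite fi5 ?fi4' ?fi1 //.
  by move: nB; rewrite !inE negb_or => /andP[].
- move=> B j nB; rewrite fr5 // fr1 //.
  by move: nB; rewrite !inE negb_or => /andP[].
- exact: rE5.
- have fd i : 0 <= f i <= dem i by rewrite f0 /=; have := fgd i; have := g0 i; lra.
  have ad' i : a i <= dem i by case/andP: (ad i).
  exists c, (node_row st5 k.+1).
  have gs := greedy_inv_split fd g0 ad' aS cP gI5.
  (* For an excluded commodity the right row still holds [g i]; this equals [a i - f i] since one of
     the flows is the whole demand and the other zero. *)
  split=> // i; rewrite gE5 ltnS (classifies_le2 i cP); case: ifP => // /negbFE ei.
  have [/(_ i ei) -> _ _ _] := gs.
  have /andP[da dfg] : excluded f g a dem i := ei.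
  suff : g i = a i - f i by [].
  by case/orP: dfg; have := ad' i; have := fgd i; have := f0 i; have := g0 i; lra.
Qed.
End Distribute.

Lemma nth_allpairs (A B C : Type) (F : A -> B -> C) (x0 : A) (y0 : B) (z0 : C)
    (s : seq A) (t : seq B) k j :
  (k < size s)%N -> (j < size t)%N ->
  nth z0 [seq F x y | x <- s, y <- t] (k * size t + j) = F (nth x0 s k) (nth y0 t
    j).
Proof.
move=> ks jt; elim: s k ks => [|x s IH] [|k] //= ks; rewrite nth_cat size_map.
  by rewrite jt (nth_map y0).
by rewrite mulSn -addnA ltnNge leq_addr /= addKn IH.
Qed.

(** * The forward pass over the whole tree *)

Section DistributeTree.
Variables (R : realFieldType) (G : digraph) (I : multiflow_instance R G).
Variable X : 'M[R]_(na G, nk I).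
Hypothesis X_flow : is_multiflow X.
Local Notation n := (nk I).
Local Notation dem := (@dem R G I).
Implicit Types (st : state R) (w l r : sptree 'I_(na G)) (i : 'I_(nk I)).
Implicit Types (A : {set 'I_(na G)}) (a : 'I_(nk I) -> R).

Lemma cell_in_row p q i m :
  (m <= n)%N -> (q * n <= p * n + i < q * n + m)%N -> p = q.
Proof.
move=> mn /andP[le lt]; have lin := ltn_ord i.
have n0 : (0 < n)%N := leq_ltn_trans (leq0n i) lin.
have : (q * n < p.+1 * n)%N by rewrite mulSn; lia.
have : (p * n < q.+1 * n)%N by rewrite mulSn; lia.
by rewrite !ltn_pmul2r //; lia.
Qed.

Definition distribute_frame A (k m : nat) st st' : Prop :=
  [/\ iframe [:: 8; 9; 10; 11]%N st st',
      forall B j, B \notin [:: 2; 3; 4]%N -> rmem st' B j = rmem st B j,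
      forall p i, ~~ (k < p < k + m)%N -> node_row st' p i = node_row st p i
    & forall e i, e \notin A -> rmem st' 2%N (e * n + i)%N = rmem st 2%N (e * n +
      i)%N].

Lemma distribute_frame_weaken A A' k k' m m' st st' :
  A \subset A' -> (k' <= k)%N -> (k + m <= k' + m')%N ->
  distribute_frame A k m st st' -> distribute_frame A' k' m' st st'.
Proof.
move=> /subsetP AA kk km [fi fr fw fo]; split=> //.
  by move=> p i np; apply: fw; apply: contraNN np => ?; lia.
by move=> e i eA; apply: fo; apply: contraNN eA; exact: AA.
Qed.

Lemma distribute_frame_trans A k m st1 st2 st3 :
  distribute_frame A k m st1 st2 -> distribute_frame A k m st2 st3 ->
  distribute_frame A k m st1 st3.
Proof.
move=> [i12 r12 w12 o12] [i23 r23 w23 o23]; split.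
- by move=> B j nB; rewrite i23 // i12.
- by move=> B j nB; rewrite r23 // r12.
- by move=> p i np; rewrite w23 // w12.
- by move=> e i eA; rewrite o23 // o12.
Qed.

Lemma distribute_frame_env A k m st st' :
  distribute_frame A k m st st' -> env X st -> env X st'.
Proof.
move=> [fi fr _ _]; apply: env_frame => B j leB.
  by apply: fi; rewrite !inE; lia.
by apply: fr; rewrite !inE; lia.
Qed.

Lemma distribute_frame_code A k m st st' w j : distribute_frame A k m st st' ->
  coded w j (imem st 5%N) -> coded w j (imem st' 5%N).
Proof. by case=> fi _ _ _; apply: coded_ext => p; rewrite fi. Qed.

(** Rows change strictly after [k], and [stored_below] looks strictly after [p]; hence the shift by
    one in both comparisons. *)
Lemma distribute_frame_below A k m st st' w p : distribute_frame A k m st st' ->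
  (p + tree_size w <= k.+1)%N || (k + m <= p.+1)%N ->
  stored_below X w p st -> stored_below X w p st'.
Proof.
move=> [fi _ fw _] dis; apply: stored_below_frame => [j|j i] pj;
  first by rewrite fi.
by apply: fw; apply/negP => /andP[]; lia.
Qed.

Lemma distribute_frame_output A k m st st' e i : distribute_frame A k m st st' ->
  e \notin A -> output I st' e i = output I st e i.
Proof. by case=> _ _ _ fo eA; rewrite !mxE fo. Qed.

(* Stated in continuation-passing form, so that the hypotheses for the two
   children of a node concern successive iterations of one and the same loop. *)
Definition distributes w : Prop := forall k st a Q t,
  admissible X w a -> env X st -> coded w k (imem st 5%N) ->
  imem st 8%N 0%N = k -> (k + tree_size w < na G + na G)%N -> stored_below X w k
    st ->
  (forall i, node_row st k i = a i) ->
  (forall st', distribute_frame (arcs (subdig w)) k (tree_size w) st st' ->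
     imem st' 8%N 0%N = (k + tree_size w)%N -> realizes X w a (output I st') ->
     runs distribute st' Q t) ->
  runs distribute st Q (t + tree_size w * (28 * n + 14))%N.

Lemma distribute_step k st Q t t' :
  env X st -> imem st 8%N 0%N = k -> (k.+1 < na G + na G)%N ->
  runs distribute_node st (fun st' => imem st' 8%N 0%N = k /\
    runs distribute (State (update (imem st') 8 0 k.+1) (rmem st')) Q t) t' ->
  runs distribute st Q (t + (t' + 2))%N.
Proof.
move=> [e1 _ _ _ _] kE kle nodeR.
apply: (@runs_le _ _ _ _ ((t' + 1) + t).+1); first by lia.
apply: runs_while_step; first by rewrite /= kE e1 -ltnNge; lia.
apply: runs_seq; apply: runs_weaken (leqnn _) nodeR => // st' [k' next].
by apply: runs_iset; rewrite /= k' addn1.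
Qed.

Lemma distributes_leaf e : distributes (QNode e).
Proof.
move=> k st a Q t adm ev cw kE kle _ aE next.
rewrite mul1n; apply: (@runs_le _ _ _ _ (t + ((n * 3).+2.+1 + 2))%N); first by lia.
apply: (distribute_step ev kE); first by rewrite /tree_size /= in kle; lia.
have [e1 nE e3 e4 e5] := ev.
apply: runs_if; rewrite [beval _ _]/= kE cw /=.
have eo : (e <= na G + na G)%N by have := ltn_ord e; lia.
apply: (@runs_weaken _ _ _ _ _ (n * 3).+2 _ _ (leqnn _)); last first.
  apply: (@runs_row_set_ord _ 2 _ _ _ n (e * n)%N a nE) => st' i fi fr iE.
  rewrite /= iE !fi // kE cw subn2 /= !e3 //;
    last by rewrite /tree_size /= in kle; lia.
  by split=> //; rewrite fr // -[LHS]/(node_row st k i) aE.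
move=> st' [fi fr fw]; split; first by rewrite fi.
apply: next; rewrite /tree_size /=.
- split=> /=.
  + move=> B j; rewrite !inE !negb_or => /and4P[B8 B9 _ _].
    by rewrite /= /update (negPf B8) /= fi // inE.
  + by move=> B j; rewrite !inE negb_or => /andP[/negPf B2 _]; rewrite fr // B2.
  + by move=> p i _; rewrite /node_row fr.
  + move=> e' i; rewrite inE => ee; rewrite fr //=; apply: contraNN ee => cellP.
    by apply/eqP/val_inj; exact: cell_in_row (leqnn _) cellP.
- by rewrite /update /= addn1.
- by apply: realizes_leaf => // i; rewrite mxE fw.
Qed.

Lemma distributes_children l r k st al ar Q t :
  [disjoint arcs (subdig l) & arcs (subdig r)] ->
  distributes l -> distributes r ->
  admissible X l al -> admissible X r ar -> env X st ->
  coded l k.+1 (imem st 5%N) -> coded r (k.+1 + tree_size l) (imem st 5%N) ->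
  imem st 8%N 0%N = k.+1 -> (k.+1 + (tree_size l + tree_size r) < na G + na G)%N ->
  stored_below X l k.+1 st -> stored_below X r (k.+1 + tree_size l) st ->
  (forall i, node_row st k.+1 i = al i) ->
  (forall i, node_row st (k.+1 + tree_size l) i = ar i) ->
  (forall st', distribute_frame (arcs (subdig l) :|: arcs (subdig r)) k
       (tree_size l + tree_size r).+1 st st' ->
     imem st' 8%N 0%N = (k + (tree_size l + tree_size r).+1)%N ->
     realizes X l al (output I st') -> realizes X r ar (output I st') ->
     runs distribute st' Q t) ->
  runs distribute st Q (t + (tree_size l + tree_size r) * (28 * n + 14))%N.
Proof.
move=> dis Dl Dr al_adm ar_adm ev cl cr kE kle sl sr alE arE next.
apply: (@runs_le _ _ _ _ (t + tree_size r * (28 * n + 14)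
  + tree_size l * (28 * n + 14))%N); first by lia.
have r0 := tree_size_gt0 r.
apply: (Dl k.+1 st al) => //; [by lia|move=> st1 f1 k1 real1].
apply: (Dr (k.+1 + tree_size l)%N st1 ar) => //.
- exact: distribute_frame_env f1 ev.
- exact: distribute_frame_code f1 cr.
- by lia.
- by apply: distribute_frame_below f1 _ sr; lia.
- by move=> i; case: f1 => _ _ fw _; rewrite fw ?arE //; lia.
move=> st2 f2 k2 real2; apply: next => //.
- apply: (@distribute_frame_trans _ _ _ _ st1).
    by apply: distribute_frame_weaken f1; [exact: subsetUl|lia..].
  by apply: distribute_frame_weaken f2; [exact: subsetUr|lia..].
- by rewrite k2; lia.
(* The run for the right child writes no output row of an arc of the left child. *)
- apply: (realizes_ext _ real1) => e i el.
  by rewrite (distribute_frame_output _ f2) // (disjointFr dis el).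
Qed.

Lemma distributes_series l r :
  sp_decomposition (SNode l r) -> closed_at (SNode l r) ->
  within_demand X (SNode l r) -> distributes l -> distributes r ->
  distributes (SNode l r).
Proof.
move=> sp cl wd Dl Dr k st a Q t adm ev cw kE kle [sl sr] aE next.
have [spl spr [dis _ _]] := sp; have [c0 c1 c2] := cw.
have [al ar] := admissible_series X_flow sp cl wd adm.
rewrite tree_size_series in kle next *; have l0 := tree_size_gt0 l;
  have r0 := tree_size_gt0 r.
rewrite mulSn [(_ * n + _ + _)%N]addnC addnA.
apply: (@runs_le _ _ _ _ (t + (tree_size l + tree_size r) * (28 * n + 14)
  + (((n * 3).+2 + (n * 3).+2).+2 + 2))%N); first by lia.
apply: (distribute_step ev kE); first by lia.
have [e1 nE e3 e4 e5] := ev.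
have [zl rl bl] := (storedE X l k.+1 st).1 sl.
have [zr rr br] := (storedE X r (k.+1 + tree_size l) st).1 sr.
do 2!(apply: runs_if; rewrite [beval _ _]/= kE c0 /=).
apply: runs_seq; apply: (@runs_weaken _ _ _ _ _ (n * 3).+2 _ _ (leqnn _));
  last first.
  apply: (@runs_row_set_ord _ 3 _ _ _ n ((k.+1 + tree_size l) * n)%N
    (fun i => flow X r i + a i - flow X l i) nE) => st' i fi fr iE.
  have k8 : imem st' 8%N 0%N = k by rewrite fi.
  have z7 : imem st' 7%N k.+1 = tree_size l by rewrite fi.
  rewrite /= iE k8 addn1 z7 !fi // !e3; [|lia..]; split=> //.
  (* Only entries below [i] of the right row are overwritten so far, so column [i] is still the old
     one in every row. *)
  have same p : rmem st' 3%N (p * n + i)%N = node_row st p i.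
    apply: fr; apply/negP => /andP[_ cellP].
    by move: (cellP); rewrite (cell_in_row (ltnW (ltn_ord i)) cellP) ltnn andbF.
  by rewrite !same rr rl aE.
move=> st1 [fi1 fr1 fw1]; have n1E : imem st1 0%N 2%N = n by rewrite fi1.
have row1 p i : p != (k.+1 + tree_size l)%N -> node_row st1 p i = node_row st p i.
  move=> pr; apply: fr1 => /=; apply: contraNN pr => cellP.
  by apply/eqP; exact: cell_in_row (leqnn _) cellP.
apply: (@runs_weaken _ _ _ _ _ (n * 3).+2 _ _ (leqnn _)); last first.
  apply: (@runs_row_set_ord _ 3 _ _ _ n (k.+1 * n)%N a n1E) => st' i fi fr iE.
  have k8 : imem st' 8%N 0%N = k by rewrite fi // fi1.
  rewrite /= iE k8 addn1 !fi // !fi1 // !e3; [|lia..]; split=> //.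
  rewrite fr /=; last by rewrite negb_and -!ltnNge mulSn; apply/orP; left;
    have := ltn_ord i; lia.
  by rewrite -[LHS]/(node_row st1 k i) row1 ?aE //; lia.
move=> st2 [fi2 fr2 fw2]; split; first by rewrite fi2 // fi1.
have row2 p i : p != k.+1 -> node_row st2 p i = node_row st1 p i.
  move=> pr; apply: fr2 => /=; apply: contraNN pr => cellP.
  by apply/eqP; exact: cell_in_row (leqnn _) cellP.
set st3 := State _ _.
have f3 : distribute_frame set0 k (tree_size l + tree_size r).+1 st st3.
  split=> /=.
  - move=> B j; rewrite !inE !negb_or => /and4P[B8 B9 _ _].
    by rewrite /= /update (negPf B8) /= fi2 ?fi1 // inE.
  - move=> B j; rewrite !inE !negb_or => /and3P[_ B3 _].
    by rewrite /= fr2 ?fr1 // (negPf B3).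
  - move=> p i np; rewrite -[LHS]/(node_row st2 p i) row2 ?row1 //;
      by apply: contraNneq np => ->; lia.
  - by move=> e i _; rewrite /= fr2 // fr1.
apply: (distributes_children (k := k) dis Dl Dr al ar) => //=.
- exact: distribute_frame_env f3 ev.
- exact: distribute_frame_code f3 c1.
- exact: distribute_frame_code f3 c2.
- by lia.
- by apply: stored_below_frame bl => [j _|j i jk];
    rewrite /= /update /= ?fi2 ?fi1 //;
    rewrite -[LHS]/(node_row st2 j i) row2 ?row1 //; lia.
- by apply: stored_below_frame br => [j _|j i jk];
    rewrite /= /update /= ?fi2 ?fi1 //;
    rewrite -[LHS]/(node_row st2 j i) row2 ?row1 //; lia.
- by move=> i; rewrite -[LHS]/(node_row st2 _ i) row2 -?fw1 //; lia.
move=> st4 f4 k4 reall realr; apply: next => //.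
  apply: distribute_frame_trans f4.
  by apply: distribute_frame_weaken f3; rewrite ?sub0set.
exact: realizes_series adm reall realr.
Qed.

Lemma distributes_parallel l r :
  sp_decomposition (PNode l r) -> closed_at (PNode l r) ->
  within_demand X (PNode l r) -> distributes l -> distributes r ->
  distributes (PNode l r).
Proof.
move=> sp cl wd Dl Dr k st a Q t adm ev cw kE kle [sl sr] aE next.
have [spl spr [dis _ _ _]] := sp; have [c0 c1 c2] := cw.
rewrite tree_size_parallel in kle next *.
have l0 := tree_size_gt0 l; have r0 := tree_size_gt0 r.
rewrite mulSn [(_ * n + _ + _)%N]addnC addnA.
(* The 14 per node is 10 from the split, two tests for the node type, and the loop test and
   increment. *)
apply: (@runs_le _ _ _ _ (t + (tree_size l + tree_size r) * (28 * n + 14)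
  + ((28 * n + 10).+2 + 2))%N); first by lia.
apply: (distribute_step ev kE); first by lia.
have [zl rl bl] := (storedE X l k.+1 st).1 sl.
have [zr rr br] := (storedE X r (k.+1 + tree_size l) st).1 sr.
do 2!(apply: runs_if; rewrite [beval _ _]/= kE c0 /=).
have ctx : node_ctx X k (tree_size l) st by split=> //; lia.
have [a0 aS _ _] := adm.
have fg i : node_row st k.+1 i + node_row st (k.+1 + tree_size l) i
    = flow X (PNode l r) i by rewrite rl rr flow_parallel.
apply: (@runs_weaken _ _ _ _ _ (28 * n + 10)%N _ _ (leqnn _)); last first.
  apply: (split_node_runs ctx) => [i|i|i|i|].
  - by rewrite aE; exact: a0.
  - by rewrite rl flow_ge0.
  - by rewrite rr flow_ge0.
  - by rewrite fg flow_le_dem.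
  - by under eq_bigr do rewrite aE; rewrite aS; apply: eq_bigr => i _; rewrite fg.
move=> st2 [fi2 fr2 fw2 [c [L [cP LP lE rE]]]]; split; first by rewrite fi2.
have exE f g a' i : (forall i, f i = flow X l i) -> (forall i, g i = flow X r i) ->
    (forall i, a' i = a i) ->
    excluded f g a' dem i = excluded (flow X l) (flow X r) a dem i.
  by move=> fE gE a'E; rewrite /excluded fE gE a'E.
have exE' i : excluded (node_row st k.+1) (node_row st (k.+1 + tree_size l))
    (node_row st k) dem i = excluded (flow X l) (flow X r) a dem i by exact: exE.
have cP' : classifies (flow X l) (flow X r) a dem c.
  case: cP => c3 cN c00 c02; split=> // i; rewrite -exE'; first exact: c3.
  by move=> ei; rewrite -aE; exact: cN.
have LP' : greedy_split (flow X l) (flow X r) a dem c L.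
  case: LP => LE La LS cut; split.
  - by move=> i; rewrite -exE' -rl; exact: LE.
  - by move=> i; rewrite -aE; exact: La.
  - by rewrite LS; apply: eq_bigr => i _; rewrite rl.
  - case: cut => [cut|[j ej cut]]; [left|right].
      by move=> i; rewrite -exE' -aE; exact: cut.
    exists j; first by rewrite -exE'.
    by move=> i; rewrite -exE' /cut_at -aE; exact: cut.
have [al ar LR] := admissible_parallel X_flow sp cl wd adm cP' LP'.
set st3 := State _ _.
have f3 : distribute_frame set0 k (tree_size l + tree_size r).+1 st st3.
  split=> /=.
  - move=> B j; rewrite !inE !negb_or => /and4P[B8 B9 B10 B11].
    by rewrite /= /update (negPf B8) /= fi2 // !inE !negb_or B9 B10.
  - by move=> B j; rewrite !inE !negb_or => /and3P[_ B3 B4];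
      rewrite fr2 // !inE negb_or B3.
  - move=> p i np; rewrite -[LHS]/(node_row st2 p i) fw2 //;
      by apply: contraNneq np => ->; lia.
  - by move=> e i _; rewrite /= fr2.
apply: (distributes_children (k := k) dis Dl Dr al ar) => //=.
- exact: distribute_frame_env f3 ev.
- exact: distribute_frame_code f3 c1.
- exact: distribute_frame_code f3 c2.
- by lia.
- by apply: stored_below_frame bl => [j _|j i jk]; rewrite /= /update /= ?fi2 //;
    rewrite -[LHS]/(node_row st2 j i) fw2 //; lia.
- by apply: stored_below_frame br => [j _|j i jk]; rewrite /= /update /= ?fi2 //;
    rewrite -[LHS]/(node_row st2 j i) fw2 //; lia.
- by move=> i; rewrite -[LHS]/(node_row st2 _ i) rE aE.
move=> st4 f4 k4 reall realr; apply: next => //.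
  apply: distribute_frame_trans f4.
  by apply: distribute_frame_weaken f3; rewrite ?sub0set.
exact: realizes_parallel adm LR reall realr.
Qed.

Lemma distributesP w :
  sp_decomposition w -> closed_at w -> within_demand X w -> distributes w.
Proof.
elim: w => [e|l IHl r IHr|l IHl r IHr] sp cl wd; first exact: distributes_leaf.
  have [spl spr _] := sp; have [cll clr] := closed_at_series sp cl.
  have [wdl wdr] := within_demand_series X_flow sp cl wd.
  by apply: distributes_series => //; [exact: IHl|exact: IHr].
have [spl spr _] := sp; have [cll clr] := closed_at_parallel sp cl.
have [wdl wdr] := within_demand_parallel X_flow sp wd.
by apply: distributes_parallel => //; [exact: IHl|exact: IHr].
Qed.

Definition unsplit : cmd :=
  Seq set_offsets (Seq (ISet 8 (ICst 0) last_pos)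
    (Seq collect distribute)).

Lemma set_offsets_runs T :
  runs set_offsets (input_state T X) (fun st =>
    [/\ forall B j, B \notin [:: 6;
      8]%N -> imem st B j = imem (input_state T X) B j,
        rmem st = rmem (input_state T X)
      & forall p, (p <= na G + na G)%N -> imem st 6%N p = (p * n)%N])
    ((na G + na G) * 3).+2.
Proof.
pose Inv j (st : state R) := [/\ imem st 8%N 0%N = j,
  forall B x, B \notin [:: 6; 8]%N -> imem st B x = imem (input_state T X) B x,
  rmem st = rmem (input_state T X)
  & forall p, (p <= j)%N -> imem st 6%N p = (p * n)%N].
apply: (@runs_weaken _ _ _ (Inv (na G + na G)%N) _ ((na G + na G) * 3).+2) => //.
  by move=> st [].
apply: runs_for_up.
- split=> //=.
    by move=> B x; rewrite !inE negb_or /= /update => /andP[_ /negPf->].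
  (* Row 0 needs no write, as cells outside the input contain 0. *)
  by move=> p; rewrite leqn0 => /eqP->; rewrite /update /= /load nth_nil.
- by move=> j st _ [jE fi _ _]; split=> //=; rewrite !fi.
move=> j st jN [jE fi fr E]; apply: runs_iset; rewrite /= jE; split=> //=.
- by rewrite /update /= jE.
- move=> B x; rewrite !inE negb_or /= /update => /andP[/negPf B6 /negPf B8].
  by rewrite B8 B6 /= fi // !inE B6 B8.
- move=> p; rewrite /update /= addn1 leq_eqVlt => /orP[/eqP->|pj].
    by rewrite eqxx E // fi //= mulSn addnC.
  by rewrite ltn_eqF // E.
Qed.

Lemma env_input T st :
  (forall B j, B \notin [:: 6; 8]%N -> imem st B j = imem (input_state T X) B j) ->
  rmem st = rmem (input_state T X) ->
  (forall p, (p <= na G + na G)%N -> imem st 6%N p = (p * n)%N) -> env X st.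
Proof.
move=> fi fr e6; split; rewrite ?fi ?fr //= /load /=.
  by move=> i; rewrite (nth_map i) ?size_enum_ord // nth_ord_enum.
move=> e i; have := @nth_allpairs _ _ _ (fun e i => X e i) e i 0
  (enum 'I_(na G)) (enum 'I_n) e i.
by rewrite !size_enum_ord !nth_ord_enum => -> //; exact: ltn_ord.
Qed.

Lemma unsplit_runs T : is_sptree T ->
  runs unsplit (input_state T X) (fun st => realizes X T (flow X T) (output I st))
    (((na G + na G) * 3).+2
       + (1 + ((1 + tree_size T * (n * 3 + 7)) + (1 + tree_size T * (28 * n +
         14)))))%N.
Proof.
move=> sT; have sp := is_sptree_sp sT; have cl := closed_at_root sT.
have wd := within_demand_root X_flow sT; have [_ _ aT] := sT.
have sizeE : (tree_size T).+1 = (na G + na G)%N.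
  by rewrite tree_size_arcs // aT cardsT card_ord.
apply: runs_seq; apply: runs_weaken (leqnn _) (set_offsets_runs T).
move=> st [fi fr e6]; have ev := env_input fi fr e6.
apply: runs_seq; apply: runs_iset; rewrite /=.
set st1 := State _ _.
have ev1 : env X st1 by apply: env_frame ev => // B j leB; rewrite /= /update;
  case: eqP => // E; rewrite E in leB.
have cT : coded T 0 (imem st1 5%N).
  by apply: coded_nth => j _; rewrite add0n /= /update /= fi.
have k1 : imem st1 8%N 0%N = (0 + tree_size T)%N.
  by have [e1 _ _ _ _] := ev; rewrite /= /update /= e1 -sizeE subn1.
apply: runs_seq; apply: (collect_runs sp ev1 cT k1); first by lia.
move=> st2 f2 k2 /storedE[_ fT bT]; apply: runs_while_stop => /=;
  first by rewrite k2.
have ev2 := collect_frame_env f2 ev1; have [e1 _ _ _ _] := ev2.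
apply: (@distributesP T sp cl wd 0%N st2 (flow X T) _ 1%N) => //.
- exact: admissible_root.
- exact: collect_frame_code f2 cT.
- by rewrite add0n -sizeE.
- move=> st3 f3 k3 real; apply: runs_while_stop => //=.
  have [e3 _ _ _ _] := distribute_frame_env f3 ev2.
  by rewrite k3 e3 add0n -sizeE subn1 leqnn.
Qed.
End DistributeTree.

Theorem theorem4 :
  exists (P : cmd) (p : {poly nat}),
    forall (R : realFieldType) (G : digraph) (T : sptree 'I_(na G))
           (I : multiflow_instance R G) (X : 'M[R]_(na G, nk I)),
      is_sptree T -> is_multiflow X ->
      exists (st : state R) (t : nat),
        [/\ exec P (input_state T X) st t,
            (t <= p.[input_size I])%N,
            is_multiflow (output I st),
            forall e : 'I_(na G),
              total_flow (output I st) e = total_flow X e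
          & almost_unsplittable T (output I st)].
Proof.
(* The passes take at most [62 * na * nk + 48 * na + 5] steps; 100 is a generous common factor. *)
exists unsplit, (100%:P * ('X + 1) ^+ 2)%R => R G T I X sT X_flow.
have [st [t [ex tle real]]] := unsplit_runs X_flow sT.
have [mf tf au] := realizes_root X_flow sT real.
exists st, t; split=> //; apply: leq_trans tle _.
rewrite hornerCM horner_exp hornerD hornerX hornerC.
have sizeE : (tree_size T).+1 = (na G + na G)%N.
  by have [sp _ aT] := sT; rewrite tree_size_arcs // aT cardsT card_ord.
rewrite expr2 -[leqRHS]/(100 * ((input_size I + 1) * (input_size I + 1)))%N.
by rewrite /input_size; nia.
Qed.
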